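(* Let $U\subseteq\mathbb{R}$ be open and $f\in\mathcal{D}'(U)$. Suppose there is a closed null set $E\subset U$ such that (I) $\operatorname{sing\,supp}_{PF}f\subseteq E$, and (II) for each $t_0\in E$ there are an open neighborhood $V_{t_0}$ of $t_0$ and a local pseudomeasure $f_{t_0}$ on $V_{t_0}$ such that $f=(t-t_0)f_{t_0}$ on $V_{t_0}$. Then $\operatorname{sing\,supp}_{PF}f=\emptyset$, that is, $f$ is a local pseudofunction on $U$.
   Context: The Fourier transform is $\hat\varphi(t)=\int e^{-itx}\varphi(x)\,\mathrm{d}x$, extended to tempered distributions by duality. A tempered distribution $g$ is a pseudomeasure if $\hat g\in L^\infty(\mathbb{R})$, and a pseudofunction if moreover $\hat g(x)\to0$ as $|x|\to\infty$. A distribution on an open set $V$ is a local pseudofunction (local pseudomeasure) on $V$ if each point of $V$ has an open neighborhood on which it coincides with a pseudofunction (pseudomeasure). For $f\in\mathcal{D}'(U)$, $\operatorname{sing\,supp}_{PF}f$ is the complement in $U$ of the largest open subset of $U$ on which $f$ is a local pseudofunction. *)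

(* Defs.v *)
From mathcomp Require Import all_boot all_algebra.
From mathcomp Require Import all_classical all_reals all_analysis.
From mathcomp Require Export complex.
Import GRing.Theory Num.Theory numFieldTopology.Exports numFieldNormedType.Exports.
Set Implicit Arguments. Unset Strict Implicit. Unset Printing Implicit Defensive.
Local Open Scope ring_scope.
Local Open Scope classical_set_scope.

Section Defs.
Variable R : realType.
Local Notation C := R[i].

Definition cRe (z : C) : R := complex.Re z.
Definition cIm (z : C) : R := complex.Im z.
Definition cabs (z : C) : R := Num.sqrt (cRe z ^+ 2 + cIm z ^+ 2).

Definition smooth (g : R -> R) : Prop :=
  forall (n : nat) (x : R), derivable (derive1n n g) x 1.

Definition vanishes_outside (K : set R) (phi : R -> C) : Prop :=
  forall x, ~ K x -> phi x = 0.

Definition test_fun (O : set R) (phi : R -> C) : Prop :=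
  smooth (cRe \o phi) /\ smooth (cIm \o phi) /\
  exists K : set R, [/\ compact K, K `<=` O & vanishes_outside K phi].

(* distributions on an open set U : complex-linear functionals on D(U) satisfying
   the usual seminorm continuity estimate on each compact K of U
   (values on non-test functions are irrelevant). *)
Definition is_distribution (U : set R) (f : (R -> C) -> C) : Prop :=
  (forall phi psi (a : C), test_fun U phi -> test_fun U psi ->
     f (fun x => phi x + a * psi x) = f phi + a * f psi) /\
  (forall K : set R, compact K -> K `<=` U ->
     exists (c : R) (N : nat), forall phi, test_fun U phi -> vanishes_outside K phi ->
       forall M : R, (forall k x, (k <= N)%N ->
            `|derive1n k (cRe \o phi) x| <= M /\ `|derive1n k (cIm \o phi) x| <= M) ->
       cabs (f phi) <= c * M).

Definition cint (g : R -> C) : C :=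
  ((Rintegral (@lebesgue_measure R) setT (cRe \o g)) +i*
   (Rintegral (@lebesgue_measure R) setT (cIm \o g)))%C.

Definition expi (t : R) : C := ((cos t) +i* (sin t))%C.

Definition fourier (phi : R -> C) (t : R) : C :=
  cint (fun x => expi (- (t * x)) * phi x).

(* The tempered distribution g with hat g = h, evaluated at phi :
   <g, phi> = <g, hat psi> = \int h psi  where psi(x) = (2 pi)^-1 hat phi(-x). *)
Definition inv_fourier_pair (h : R -> C) (phi : R -> C) : C :=
  cint (fun x => h x * ((2 * pi)^-1)%:C%C * fourier phi (- x)).

(* h is (a representative of) an element of L^infty(R) *)
Definition Linf (h : R -> C) : Prop :=
  measurable_fun setT (cRe \o h) /\ measurable_fun setT (cIm \o h) /\
  exists M : R, forall x, cabs (h x) <= M.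

Definition vanishes_at_infty (h : R -> C) : Prop :=
  forall e : R, 0 < e -> exists A : R, forall x, A < `|x| -> cabs (h x) < e.

(* f coincides on the open set O with a pseudomeasure g (hat g = h in L^infty) *)
Definition coincides_with_pseudomeasure (O : set R) (f : (R -> C) -> C) : Prop :=
  exists h, Linf h /\ forall phi, test_fun O phi -> f phi = inv_fourier_pair h phi.

Definition coincides_with_pseudofunction (O : set R) (f : (R -> C) -> C) : Prop :=
  exists h, Linf h /\ vanishes_at_infty h /\
    forall phi, test_fun O phi -> f phi = inv_fourier_pair h phi.

Definition local_pseudomeasure (V : set R) (f : (R -> C) -> C) : Prop :=
  forall x, V x -> exists O : set R,
    [/\ open O, O x, O `<=` V & coincides_with_pseudomeasure O f].

Definition local_pseudofunction (V : set R) (f : (R -> C) -> C) : Prop :=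
  forall x, V x -> exists O : set R,
    [/\ open O, O x, O `<=` V & coincides_with_pseudofunction O f].

Definition sing_supp_PF (U : set R) (f : (R -> C) -> C) : set R :=
  U `\` \bigcup_(W in [set W : set R | [/\ open W, W `<=` U & local_pseudofunction W f]]) W.

End Defs.

(* Main.v *)
Require Import Defs.
From mathcomp Require Import all_boot all_order all_algebra.
From mathcomp Require Import all_classical all_reals all_analysis.
From mathcomp Require Import measurable_realfun complex ring lra.
Import Order.TTheory GRing.Theory Num.Theory numFieldTopology.Exports numFieldNormedType.Exports.
Set Implicit Arguments.
Unset Strict Implicit.
Unset Printing Implicit Defensive.
Local Open Scope ring_scope.
Local Open Scope classical_set_scope.

(** Let S be the singular support and suppose it is nonempty.  Near t in S, f = (x - t) g
    with g a pseudomeasure, so |f(psi)| <= n A((x - t) psi) for psi supported within 1/n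
    of t, where A(psi) is the L^1 norm of the Fourier transform.  By the Baire category
    theorem one n serves a dense set of t in some S /\ I, I an open interval.  Cut a test
    function phi on I by a smooth partition of unity of mesh d.  A cell away from S
    contributes o(1) to f(phi e_l) as |l| -> oo, e_l(x) = exp(- i l x).  On a cell meeting S,
    A((x - t) phi e_l) = O(d), uniformly in l, for a suitable t at distance O(d).  Since S
    is a null set, the number of those cells is o(1/d), so f(phi e_l) -> 0 and f is a
    pseudofunction on I, a contradiction. *)

(** * Complex-valued integrals *)

(** The estimate at a single t in S comes with a constant and a neighborhood that depend on t in no
    controlled way; hence the category argument. It yields only density, so a cell is compared with
    a point t near it, not necessarily in it. The norm A fits for three reasons: modulation leaves
    it unchanged, which gives uniformity in l; affine changes of variable leave it unchanged, so a
    cell of width d can be rescaled to unit size; and it is submultiplicative up to a constant, so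
    phi can be split off. About 1/d cells contributing O(d) each would only give a bounded total;
    the nullity of S makes it small. Formally, l |-> f(phi e_l) is the Fourier transform of phi f.
    Its decay yields a pseudofunction once Fourier inversion is at hand and the function is known to
    be bounded and measurable, which follows from f = (x - x0) g on I. Inversion is proved with an
    unspecified constant c != 0, and the bounds keep harmless factors such as 2 and 1/|c|. *)

Section ComplexModulus.
Variable R : realType.
Local Notation C := R[i].
Implicit Types z w : C.

Lemma cabsE z : cabs z = ComplexField.Normc.normc z.
Proof. by case: z. Qed.

Lemma cabs_ge0 z : 0 <= cabs z.
Proof. exact: sqrtr_ge0. Qed.

Lemma cabsM z w : cabs (z * w) = cabs z * cabs w.
Proof. by rewrite !cabsE ComplexField.Normc.normcM. Qed.

Lemma cabsD z w : cabs (z + w) <= cabs z + cabs w.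
Proof. by rewrite !cabsE le_normcD. Qed.

Lemma cabsN z : cabs (- z) = cabs z.
Proof. by rewrite !cabsE normcN. Qed.

Lemma cabsB_triangle z w a : cabs (z - w) <= cabs (a - z) + cabs (a - w).
Proof.
have -> : z - w = (z - a) + (a - w) by rewrite addrA subrK.
by rewrite (le_trans (cabsD _ _))// -(cabsN (a - z)) opprB.
Qed.

Lemma cabs0 : cabs (0 : C) = 0.
Proof. by rewrite cabsE ComplexField.Normc.normc0. Qed.

Lemma cabs_eq0 z : cabs z = 0 -> z = 0.
Proof. by rewrite cabsE => /ComplexField.Normc.eq0_normc. Qed.

Lemma cabs_real (x : R) : cabs x%:C%C = `|x|.
Proof. by rewrite /cabs /= expr0n addr0 sqrtr_sqr. Qed.

Lemma normr_cRe z : `|cRe z| <= cabs z.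
Proof. by rewrite -sqrtr_sqr ler_wsqrtr// lerDl sqr_ge0. Qed.

Lemma normr_cIm z : `|cIm z| <= cabs z.
Proof. by rewrite -sqrtr_sqr ler_wsqrtr// lerDr sqr_ge0. Qed.

Lemma cabs_le z : cabs z <= `|cRe z| + `|cIm z|.
Proof.
rewrite -[leRHS]ger0_norm ?addr_ge0// -sqrtr_sqr ler_wsqrtr// sqrrD.
by rewrite !real_normK ?num_real// addrAC lerDl mulrn_wge0// mulr_ge0.
Qed.

Lemma cReD z w : cRe (z + w) = cRe z + cRe w.
Proof. by case: z; case: w. Qed.

Lemma cImD z w : cIm (z + w) = cIm z + cIm w.
Proof. by case: z; case: w. Qed.

Lemma cReN z : cRe (- z) = - cRe z.
Proof. by case: z. Qed.

Lemma cImN z : cIm (- z) = - cIm z.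
Proof. by case: z. Qed.

Lemma cReM z w : cRe (z * w) = cRe z * cRe w - cIm z * cIm w.
Proof. by case: z; case: w. Qed.

Lemma cImM z w : cIm (z * w) = cRe z * cIm w + cIm z * cRe w.
Proof. by case: z; case: w. Qed.

Lemma complex_ext z w : cRe z = cRe w -> cIm z = cIm w -> z = w.
Proof. by case: z; case: w => /= ? ? ? ? -> ->. Qed.

Lemma expiD (s t : R) : expi (s + t) = expi s * expi t.
Proof.
apply: complex_ext; rewrite ?cReM ?cImM /cRe /cIm/=; first by rewrite cosD.
by rewrite sinD addrC.
Qed.

Lemma expi0 : expi (0 : R) = 1.
Proof. by rewrite /expi cos0 sin0. Qed.

Lemma cabs_expi (t : R) : cabs (expi t) = 1.
Proof. by rewrite /cabs /cRe /cIm /= cos2Dsin2 sqrtr1. Qed.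

End ComplexModulus.

Section ComplexMeasurable.
Variable R : realType.
Local Notation C := R[i].
Context d (T : measurableType d).
Implicit Types g h : T -> C.

Definition cmeas g :=
  measurable_fun setT (@cRe R \o g) /\ measurable_fun setT (@cIm R \o g).

Lemma cmeasM g h : cmeas g -> cmeas h -> cmeas (fun x => g x * h x).
Proof.
move=> [g1 g2] [h1 h2]; split.
  rewrite (_ : _ \o _ = ((@cRe R \o g) \* (@cRe R \o h)) \-
     ((@cIm R \o g) \* (@cIm R \o h)))%R; last by apply/funext => x/=; rewrite cReM.
  by apply: measurable_funB; apply: measurable_funM.
rewrite (_ : _ \o _ = ((@cRe R \o g) \* (@cIm R \o h)) \+
     ((@cIm R \o g) \* (@cRe R \o h)))%R; last by apply/funext => x/=; rewrite cImM.
by apply: measurable_funD; apply: measurable_funM.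
Qed.

Lemma cmeasD g h : cmeas g -> cmeas h -> cmeas (fun x => g x + h x).
Proof.
move=> [g1 g2] [h1 h2]; split.
  rewrite (_ : _ \o _ = (@cRe R \o g) \+ (@cRe R \o h))%R; last first.
    by apply/funext => x/=; rewrite cReD.
  exact: measurable_funD.
rewrite (_ : _ \o _ = (@cIm R \o g) \+ (@cIm R \o h))%R; last first.
  by apply/funext => x/=; rewrite cImD.
exact: measurable_funD.
Qed.

Lemma cmeas_cst (c : C) : cmeas (fun _ : T => c).
Proof. by split; exact: measurable_cst. Qed.

Lemma cmeas_real (g : T -> R) : measurable_fun setT g ->
  cmeas (fun x => (g x)%:C%C).
Proof. by split => //; exact: measurable_cst. Qed.

Lemma cmeas_expi (g : T -> R) : measurable_fun setT g ->
  cmeas (fun x => expi (g x)).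
Proof.
move=> mg.
have mc : measurable_fun setT (@cos R).
  by apply: continuous_measurable_fun; exact: continuous_cos.
have ms : measurable_fun setT (@sin R).
  by apply: continuous_measurable_fun; exact: continuous_sin.
by split; [exact: (measurableT_comp mc mg)|exact: (measurableT_comp ms mg)].
Qed.

Lemma measurable_cabs g : cmeas g -> measurable_fun setT (@cabs R \o g).
Proof.
move=> [g1 g2].
have msq : measurable_fun setT (@Num.sqrt R).
  by apply: continuous_measurable_fun; exact: sqrt_continuous.
apply: (measurableT_comp msq).
by apply: measurable_funD; apply: measurable_funX.
Qed.

End ComplexMeasurable.

Lemma cmeas_comp (R : realType) d d' (T : measurableType d)
    (T' : measurableType d') (g : T -> R[i]) (k : T' -> T) :
  measurable_fun setT k -> cmeas g -> cmeas (g \o k).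
Proof.
by move=> mk [g1 g2]; split;
  [exact: (measurableT_comp g1 mk)|exact: (measurableT_comp g2 mk)].
Qed.

Section ComplexIntegral.
Variable R : realType.
Local Notation C := R[i].
Let mu := @lebesgue_measure R.
Local Notation rint := (Rintegral mu setT).
Implicit Types (g h : R -> C) (G : R -> R).

Definition rintegrable G := mu.-integrable setT (EFin \o G).

Definition cintegrable g :=
  rintegrable (@cRe R \o g) /\ rintegrable (@cIm R \o g).

Lemma rintegrable_le G H : measurable_fun setT G -> rintegrable H ->
  (forall x, `|G x| <= H x) -> rintegrable G.
Proof.
move=> mG iH GH; apply: le_integrable iH => //; first exact/measurable_EFinP.
by move=> x _ /=; rewrite lee_fin (le_trans (GH x))// ler_norm.
Qed.

Lemma rintegrableD G H : rintegrable G -> rintegrable H ->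
  rintegrable (fun x => G x + H x).
Proof. by move=> iG iH; apply: (integrableD measurableT iG iH). Qed.

Lemma rintegrableZ (c : R) G : rintegrable G -> rintegrable (fun x => c * G x).
Proof. by move=> iG; exact: (integrableZl measurableT c iG). Qed.

Lemma rintegrable_norm G : rintegrable G -> rintegrable (fun x => `|G x|).
Proof. by move=> iG; exact: (integrable_abse iG). Qed.

Lemma rintegrable_meas G : rintegrable G -> measurable_fun setT G.
Proof. by move/measurable_int/measurable_EFinP. Qed.

Lemma cintegrable_le g H : cmeas g -> rintegrable H ->
  (forall x, cabs (g x) <= H x) -> cintegrable g.
Proof.
move=> [g1 g2] iH gH; split; apply: rintegrable_le iH _ => //= x;
by rewrite (le_trans _ (gH x))// ?normr_cRe ?normr_cIm.
Qed.

Lemma cintegrable_meas g : cintegrable g -> cmeas g.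
Proof. by move=> [/rintegrable_meas ? /rintegrable_meas ?]. Qed.

Lemma cintegrable_cabs g : cintegrable g -> rintegrable (@cabs R \o g).
Proof.
move=> ig; have [i1 i2] := ig.
apply: (rintegrable_le (H := fun x => `|cRe (g x)| + `|cIm (g x)|)).
- exact/measurable_cabs/cintegrable_meas.
- by apply: rintegrableD; exact: rintegrable_norm.
- by move=> x; rewrite ger0_norm ?cabs_ge0// cabs_le.
Qed.

Lemma cintegrableD g h : cintegrable g -> cintegrable h ->
  cintegrable (fun x => g x + h x).
Proof.
move=> [g1 g2] [h1 h2]; split.
  by rewrite (_ : _ \o _ = fun x => cRe (g x) + cRe (h x)) ?rintegrableD//;
    apply/funext => x/=; rewrite cReD.
by rewrite (_ : _ \o _ = fun x => cIm (g x) + cIm (h x)) ?rintegrableD//;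
  apply/funext => x/=; rewrite cImD.
Qed.

Lemma cintegrableM g h (M : R) : cmeas g -> (forall x, cabs (g x) <= M) ->
  cintegrable h -> cintegrable (fun x => g x * h x).
Proof.
move=> mg gM ih.
apply: (cintegrable_le (H := fun x => M * cabs (h x))).
- by apply: cmeasM => //; exact: cintegrable_meas.
- exact/rintegrableZ/cintegrable_cabs.
- by move=> x; rewrite cabsM ler_wpM2r ?cabs_ge0.
Qed.

Lemma cintegrableZ (c : C) g : cintegrable g -> cintegrable (fun x => c * g x).
Proof. by apply: cintegrableM => //; exact: cmeas_cst. Qed.

Lemma cintD g h : cintegrable g -> cintegrable h ->
  cint (fun x => g x + h x) = cint g + cint h.
Proof.
move=> [g1 g2] [h1 h2]; apply: complex_ext; rewrite ?cReD ?cImD/=.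
  by rewrite -RintegralD//; apply: eq_Rintegral => x _ /=; rewrite cReD.
by rewrite -RintegralD//; apply: eq_Rintegral => x _ /=; rewrite cImD.
Qed.

Lemma cintZ (c : C) g : cintegrable g ->
  cint (fun x => c * g x) = c * cint g.
Proof.
move=> [g1 g2]; apply: complex_ext; rewrite ?cReM ?cImM/=.
  rewrite -!RintegralZl// -RintegralB//; [|exact: rintegrableZ..].
  by apply: eq_Rintegral => x _ /=; rewrite cReM.
rewrite -!RintegralZl// -RintegralD//; [|exact: rintegrableZ..].
by apply: eq_Rintegral => x _ /=; rewrite cImM.
Qed.

Lemma cint0 : cint (fun _ : R => 0 : C) = 0.
Proof.
by apply: complex_ext => /=; rewrite Rintegral_cst// ?mul0r.
Qed.

Lemma rint_ge0 G : (forall x, 0 <= G x) -> 0 <= rint G.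
Proof. by move=> G0; apply: Rintegral_ge0. Qed.

Lemma rintZ (c : R) G : rintegrable G -> rint (fun x => c * G x) = c * rint G.
Proof. by move=> iG; rewrite RintegralZl. Qed.

Lemma rintD G H : rintegrable G -> rintegrable H ->
  rint (fun x => G x + H x) = rint G + rint H.
Proof. by move=> iG iH; rewrite RintegralD. Qed.

Lemma le_rint G H : rintegrable G -> rintegrable H ->
  (forall x, G x <= H x) -> rint G <= rint H.
Proof. by move=> iG iH GH; apply: le_Rintegral. Qed.

Lemma normr_rint G H : rintegrable G -> rintegrable H ->
  (forall x, `|G x| <= H x) -> `|rint G| <= rint H.
Proof.
move=> iG iH GH; apply: le_trans (le_normr_Rintegral _ iG) _ => //.
by apply: le_rint => //; exact: rintegrable_norm.
Qed.

(* The sharp constant is 1; the factor 2 spares a rotation argument. *)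
Lemma cabs_cint g H : cintegrable g -> rintegrable H ->
  (forall x, cabs (g x) <= H x) -> cabs (cint g) <= 2 * rint H.
Proof.
move=> [g1 g2] iH gH; rewrite (le_trans (cabs_le _))//= mulr_natl mulr2n.
by apply: lerD; apply: normr_rint => // x;
  rewrite (le_trans _ (gH x))// ?normr_cRe ?normr_cIm.
Qed.

End ComplexIntegral.

(** * Affine substitutions in Lebesgue integrals *)

Section AffineChange.
Variable R : realType.
Local Notation C := R[i].
Let mu := @lebesgue_measure R.
Local Notation rint := (Rintegral mu setT).

Lemma measurable_affine (a b : R) :
  measurable_fun setT (fun x : R => a * x + b).
Proof.
by apply: measurable_funD => //; apply: measurable_funM.
Qed.

(** Lebesgue measure is determined by its values on half-open intervals, and the preimage of such an
    interval is one whose length is divided by [a]. *)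
Lemma lebesgue_measure_affine (a : {nonneg R}) (b : R) (A : set R) :
  0 < a%:num -> measurable A ->
  (a%:num%:E * pushforward mu
    ((fun x => a%:num * x + b)%R : R -> measurableTypeR R) A = mu A)%E.
Proof.
move=> a0 mA; have mf := measurable_affine a%:num b.
apply/esym.
pose nu : {measure set (measurableTypeR R) -> \bar R} := mscale a (pushforward mu
  ((fun x => a%:num * x + b)%R : R -> measurableTypeR R)).
transitivity (nu mf A) => //.
apply: (@lebesgue_measure_unique R (nu mf)) => // _ [[u v] _ <-].
rewrite /nu /mscale /pushforward/=.
have E : (fun x : R => a%:num * x + b) @^-1` `]u, v] =
    `](u - b) / a%:num, (v - b) / a%:num].
  by apply/seteqP; split => x /=;
    rewrite !in_itv/= ltr_pdivrMr// ler_pdivlMr// ltrBlDr lerBrDr (mulrC x).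
have M (p q : R) : mu (`]p, q]%classic : set R) =
    (if p < q then (q - p)%:E else 0%E).
  by rewrite /mu lebesgue_measure_itv/= lte_fin; case: ifP.
pose I : set R := `](u - b) / a%:num, (v - b) / a%:num].
transitivity (a%:num%:E * mu I)%E; last by congr (_ * mu _)%E; rewrite /I -E.
rewrite /I M [LHS]M ltr_pM2r ?invr_gt0// ltrD2r.
case: ifPn => // _; last by rewrite mule0.
rewrite -EFinM; congr EFin; field; exact: lt0r_neq0.
Qed.

Lemma ge0_integral_affine (a b : R) (F : R -> \bar R) : 0 < a ->
  measurable_fun setT F -> (forall x, 0 <= F x)%E ->
  (\int[mu]_x F x = a%:E * \int[mu]_x F (a * x + b)%R)%E.
Proof.
move=> a0 mF F0; have mf := measurable_affine a b.
pose a' : {nonneg R} := NngNum (ltW a0).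
pose nu : {measure set (measurableTypeR R) -> \bar R} := mscale a' (pushforward mu
  ((fun x => a * x + b)%R : R -> measurableTypeR R)).
transitivity (\int[nu mf]_x F x)%E.
  apply: eq_measure_integral => //= A mA _.
  by have := @lebesgue_measure_affine a' b A a0 mA.
rewrite ge0_integral_mscale// ge0_integral_pushforward//.
Qed.

Lemma rintegrable_affine (a b : R) (G : R -> R) : 0 < a ->
  rintegrable G -> rintegrable (fun x => G (a * x + b)).
Proof.
move=> a0 /integrableP[mG iG]; have mf := measurable_affine a b.
apply/integrableP; split.
  by apply: (measurableT_comp (f := EFin \o G)).
have mG' : measurable_fun setT (fun x => `|(EFin \o G) x|)%E.
  exact: measurableT_comp.
move: iG; rewrite (ge0_integral_affine b a0 mG')//=.
(* Writing [+oo] as [a * +oo] lets the positive factor [a] be cancelled. *)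
rewrite -[X in (_ < X)%E](@gt0_muley R a%:E) ?lte_fin//.
by rewrite lte_pmul2l ?lte_fin.
Qed.

(** When the integral of [G] is infinite or undefined, a positive factor does not change that, and
    [fine] sends both sides to 0. So the substitution can be made before integrability is known. *)
Lemma rint_affine (a b : R) (G : R -> R) : 0 < a -> measurable_fun setT G ->
  rint G = a * rint (fun x => G (a * x + b)).
Proof.
move=> a0 /measurable_EFinP mG; rewrite /Rintegral.
suff -> : (\int[mu]_x (G x)%:E = a%:E * \int[mu]_x (G (a * x + b))%:E)%E.
  rewrite [in RHS](_ : a = fine a%:E)//.
  case: (integral _ _ _) => [r| |]/=; first by [].
    by rewrite gt0_muley ?lte_fin//= mulr0.
  by rewrite gt0_muleNy ?lte_fin//= mulr0.
rewrite [in LHS]integralE [in RHS]integralE.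
rewrite (ge0_integral_affine b a0) //; last exact: measurable_funepos.
rewrite (ge0_integral_affine b (F := (EFin \o G)^\-%E) a0) //;
  last exact: measurable_funeneg.
(* The difference of two infinities has a default value, so distributivity is checked case by
   case. *)
have mB (x y : \bar R) : (a%:E * x - a%:E * y = a%:E * (x - y))%E.
  have a0' : (0 < a%:E)%E by rewrite lte_fin.
  case: x => [x||]; case: y => [y||] /=;
    rewrite ?(gt0_muley a0') ?(gt0_muleNy a0') /= ?(gt0_muley a0') ?(gt0_muleNy a0') //.
  by transitivity (a * x - a * y)%:E => //; rewrite -mulrBr.
by rewrite mB; congr (_ * (_ - _))%E; apply: eq_integral => x _; rewrite ?funeposE ?funenegE.
Qed.

Lemma cint_affine (a b : R) (g : R -> C) : 0 < a -> cmeas g ->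
  cint g = a%:C%C * cint (fun x => g (a * x + b)).
Proof.
move=> a0 [g1 g2]; apply: complex_ext; rewrite ?cReM ?cImM/= mul0r ?subr0 ?addr0.
  exact: (rint_affine b a0 g1).
exact: (rint_affine b a0 g2).
Qed.

Lemma ge0_integral_opp (F : R -> \bar R) :
  measurable_fun setT F -> (forall x, 0 <= F x)%E ->
  (\int[mu]_x F x = \int[mu]_x F (- x)%R)%E.
Proof.
move=> mF F0.
transitivity (\int[pushforward mu (-%R : R -> measurableTypeR R)]_x F x)%E.
  by apply: eq_measure_integral => //= A mA _; rewrite lebesgue_measureN.
by rewrite ge0_integral_pushforward.
Qed.

Lemma rintegrable_opp (G : R -> R) : rintegrable G ->
  rintegrable (fun x => G (- x)).
Proof.
move=> /integrableP[mG iG]; apply/integrableP; split.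
  exact: (measurableT_comp (f := EFin \o G)).
have mG' : measurable_fun setT (fun x => `|(EFin \o G) x|)%E.
  exact: measurableT_comp.
by move: iG; rewrite (ge0_integral_opp mG').
Qed.

Lemma rint_opp (G : R -> R) : measurable_fun setT G ->
  rint G = rint (fun x => G (- x)).
Proof.
move=> /measurable_EFinP mG; rewrite /Rintegral; congr fine.
rewrite [in LHS]integralE [in RHS]integralE.
rewrite ge0_integral_opp //; last exact: measurable_funepos.
rewrite [X in (_ - X)%E = _](ge0_integral_opp (F := (EFin \o G)^\-%E)) //;
  last exact: measurable_funeneg.
by congr (_ - _)%E; apply: eq_integral => x _; rewrite ?funeposE ?funenegE.
Qed.

Lemma cint_opp (g : R -> C) : cmeas g -> cint g = cint (fun x => g (- x)).
Proof. by move=> [g1 g2]; congr (_ +i* _)%C; rewrite rint_opp. Qed.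

Lemma cintegrable_affine (a b : R) (g : R -> C) : 0 < a ->
  cintegrable g -> cintegrable (fun x => g (a * x + b)).
Proof.
by move=> a0 [g1 g2]; split; [exact: (rintegrable_affine b a0 g1)|
  exact: (rintegrable_affine b a0 g2)].
Qed.

Lemma cintegrable_opp (g : R -> C) :
  cintegrable g -> cintegrable (fun x => g (- x)).
Proof.
by move=> [g1 g2]; split; [exact: (rintegrable_opp g1)|exact: (rintegrable_opp g2)].
Qed.

(** By evenness it suffices to know the integral over the half line. This function majorizes the
    transforms of test functions and serves as a positive integrable weight. *)
Lemma rintegrable_oneDsqrV : rintegrable (fun x : R => (1 + x ^+ 2)^-1).
Proof.
apply/integrableP; split.
  by apply/measurable_EFinP; apply: continuous_measurable_fun; exact: continuous_oneDsqrV.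
have ge0 x : 0 <= (1 + x ^+ 2)^-1 :> R by rewrite invr_ge0 addr_ge0// sqr_ge0.
rewrite [X in (X < _)%E](_ : _ = \int[mu]_x ((1 + x ^+ 2)^-1)%:E)%E; last first.
  by apply: eq_integral => x _ /=; rewrite ger0_norm.
rewrite ge0_symfun_integralT//.
- by rewrite -set_itvcy (@integral0y_oneDsqr R) -EFinM ltry.
- exact: continuous_oneDsqrV.
- by move=> x /=; rewrite sqrrN.
Qed.

End AffineChange.

(** * Smooth functions *)

Section Smooth.
Variable R : realType.
Implicit Types g h : R -> R.

Lemma derive1_eq g h : (forall x : R, is_derive x 1 g (h x)) -> (derive1 g) = h.
Proof. by move=> gh; apply/funext => x; rewrite derive1E derive_val. Qed.

Lemma is_derive1 g (x : R) : derivable g x 1 -> is_derive x 1 g ((derive1 g) x).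
Proof. by move=> dg; rewrite derive1E; exact: derivableP. Qed.

(** Recursion on the derivative of [g], so that a single use of the sum, product or chain rule
    reduces the order by one. [ndiff 0] already means differentiability, so [ndiff n] speaks of
    [n + 1] derivatives. *)
Fixpoint ndiff n g : Prop :=
  (forall x : R, derivable g x 1) /\ (if n is m.+1 then ndiff m (derive1 g) else True).

Lemma ndiffP g : smooth g <-> forall n, ndiff n g.
Proof.
split=> [sg n|].
  elim: n g sg => [|n IH] g sg /=; split => //; try exact: (sg 0%N).
  by apply: IH => m x; have := sg m.+1 x; rewrite derive1Sn.
move=> h n; have {h} := h n; elim: n g => [|n IH] g [dg dg'] x; first exact: dg.
by rewrite derive1Sn; apply: IH.
Qed.

Lemma ndiffW n g : ndiff n.+1 g -> ndiff n g.
Proof.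
elim: n g => [|n IH] g; first by move=> [dg _]; split; first exact: dg.
by move=> -[dg ng]; split => //; exact: IH.
Qed.

Lemma ndiffD n g h : ndiff n g -> ndiff n h -> ndiff n (fun x => g x + h x).
Proof.
have dD g' h' : (forall x : R, derivable g' x 1) -> (forall x : R, derivable h' x 1) ->
    forall x : R, derivable (fun x => g' x + h' x) x 1.
  by move=> dg dh x; apply: (@derivableD _ _ _ g' h').
elim: n g h => [|n IH] g h [dg ng] [dh nh]; (split; first exact: dD) => //.
rewrite (_ : derive1 _ = fun x => (derive1 g) x + (derive1 h) x); first exact: IH.
apply: derive1_eq => x; have := is_deriveD (is_derive1 (dg x)) (is_derive1 (dh x)).
exact.
Qed.

Lemma ndiffM n g h : ndiff n g -> ndiff n h -> ndiff n (fun x => g x * h x).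
Proof.
have dM g' h' : (forall x : R, derivable g' x 1) -> (forall x : R, derivable h' x 1) ->
    forall x : R, derivable (fun x => g' x * h' x) x 1.
  by move=> dg dh x; apply: (@derivableM _ _ g' h').
elim: n g h => [|n IH] g h ng nh; have [dg ng'] := ng; have [dh nh'] := nh;
  (split; first exact: dM) => //.
rewrite (_ : derive1 _ = fun x => g x * (derive1 h) x + h x * (derive1 g) x).
  by apply: ndiffD; apply: IH => //; exact: ndiffW.
apply: derive1_eq => x; have := is_deriveM (is_derive1 (dg x)) (is_derive1 (dh x)).
exact.
Qed.

Lemma smooth_derivable g (x : R) : smooth g -> derivable g x 1.
Proof. by move=> /(_ 0%N); exact. Qed.

Lemma smooth_continuous g : smooth g -> continuous g.
Proof.
by move=> sg x; apply/differentiable_continuous/derivable1_diffP; exact: smooth_derivable.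
Qed.

Lemma smooth_meas g : smooth g -> measurable_fun setT g.
Proof. by move=> sg; apply: continuous_measurable_fun; exact: smooth_continuous. Qed.

Lemma smooth_derive1 g : smooth g -> smooth (derive1 g).
Proof. by move=> sg n x; rewrite -derive1Sn; exact: sg. Qed.

Lemma smooth_primitive g : (forall x : R, derivable g x 1) -> smooth (derive1 g) -> smooth g.
Proof. by move=> dg sg [|n] x; [exact: dg|rewrite derive1Sn; exact: sg]. Qed.

Local Opaque smooth.

Lemma smoothD g h : smooth g -> smooth h -> smooth (fun x => g x + h x).
Proof. by rewrite !ndiffP => sg sh n; exact: ndiffD. Qed.

Lemma smoothM g h : smooth g -> smooth h -> smooth (fun x => g x * h x).
Proof. by rewrite !ndiffP => sg sh n; exact: ndiffM. Qed.

Lemma smooth_cst (c : R) : smooth (fun=> c).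
Proof.
rewrite ndiffP => n; elim: n c => [|n IH] c; (split; first by move=> x; exact: derivable_cst) => //.
rewrite (_ : derive1 _ = fun=> 0) //.
by apply: derive1_eq => x; exact: is_derive_cst.
Qed.

Lemma smooth_id : smooth (fun x : R => x).
Proof.
apply: smooth_primitive => [x|]; first exact: derivable_id.
rewrite (_ : derive1 _ = fun=> 1 : R); first exact: smooth_cst.
by apply: derive1_eq => x; exact: is_derive_id.
Qed.

Lemma smoothN g : smooth g -> smooth (fun x => - g x).
Proof.
move=> sg; have := smoothM (@smooth_cst (-1)) sg.
by under eq_fun do rewrite mulN1r.
Qed.

Lemma smoothB g h : smooth g -> smooth h -> smooth (fun x => g x - h x).
Proof. by move=> sg sh; exact: smoothD sg (smoothN sh). Qed.

Lemma is_derive_affine (a b x : R) : is_derive x 1 (fun x : R => a * x + b) a.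
Proof.
have h := is_deriveD (is_deriveZ a (is_derive_id x 1)) (is_derive_cst b x 1).
rewrite (_ : (fun x => _) = a *: id + cst b); last by apply/funext.
by have := h; rewrite addr0 /GRing.scale/= mulr1.
Qed.

Lemma is_derive_comp_affine g (a b x : R) : derivable g (a * x + b) 1 ->
  is_derive x 1 (fun x : R => g (a * x + b)) (a * (derive1 g) (a * x + b)).
Proof.
move=> dg; rewrite mulrC.
exact: (@is_derive1_comp _ g (fun x => a * x + b) x _ _ (is_derive1 dg)
  (is_derive_affine a b x)).
Qed.

Lemma smooth_affine g (a b : R) : smooth g -> smooth (fun x => g (a * x + b)).
Proof.
rewrite !ndiffP => ng n; have {ng} := ng n.
have dA g' : (forall x : R, derivable g' x 1) ->
    forall x : R, derivable (fun x => g' (a * x + b)) x 1.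
  by move=> dg x; apply: ex_derive; exact: is_derive_comp_affine.
elim: n g => [|n IH] g [dg ng]; (split; first exact: dA) => //.
rewrite (_ : derive1 _ = fun x => a * (derive1 g) (a * x + b)).
  by apply: ndiffM; [exact: ((ndiffP _).1 (@smooth_cst a) n)|exact: IH].
by apply: derive1_eq => x; exact: is_derive_comp_affine.
Qed.

(** Each function is, up to sign, the derivative of the other, so the two inductions run jointly. *)
Lemma smooth_cos_sin : smooth (@cos R) /\ smooth (@sin R).
Proof.
have c' : derive1 (@cos R) = fun x => - sin x by apply: derive1_eq => x; exact: is_derive_cos.
have s' : derive1 (@sin R) = cos by apply: derive1_eq => x; exact: is_derive_sin.
suff H n : ndiff n (@cos R) /\ ndiff n (@sin R).
  by split; apply/ndiffP => n; case: (H n).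
elim: n => [|n [IHc IHs]].
  by split; (split; last by []) => x; [exact: derivable_cos|exact: derivable_sin].
split; last by split; [move=> x; exact: derivable_sin|rewrite s'].
split; first by move=> x; exact: derivable_cos.
rewrite c'.
rewrite (_ : (fun _ => _) = fun x => (-1) * sin x).
  by apply: ndiffM => //; exact: ((ndiffP _).1 (@smooth_cst (-1)) n).
by apply/funext => x; rewrite mulN1r.
Qed.

Definition smooth_cos := smooth_cos_sin.1.
Definition smooth_sin := smooth_cos_sin.2.

Lemma derive1_eq0 g (r : R) : (forall x, r < `|x| -> g x = 0) ->
  forall x, r < `|x| -> (derive1 g) x = 0.
Proof.
move=> g0 x rx; rewrite derive1E (@near_eq_derive _ _ _ _ (cst 0)) ?derive_cst//.
have : \forall y \near x, r < `|y|.
  exact: (@cvgr_norm_gt R R R (nbhs x) _ id x cvg_id _ rx).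
by apply: filterS => y ry; rewrite g0.
Qed.

End Smooth.
Local Opaque smooth.

(** * Integrals of functions with bounded support *)

Section BoundedSupport.
Variable R : realType.
Let mu := @lebesgue_measure R.
Local Notation rint := (Rintegral mu setT).
Implicit Types g h : R -> R.

Lemma supp_restrict g (r : R) : (forall x, r < `|x| -> g x = 0) ->
  g = g \_ `[- r, r].
Proof.
move=> g0; apply/funext => x; rewrite patchE; case: ifPn => //.
rewrite notin_setE/= in_itv/= => /negP; rewrite -ler_norml -ltNge; exact: g0.
Qed.

Lemma rintegrable_supp g (r : R) : continuous g ->
  (forall x, r < `|x| -> g x = 0) -> rintegrable g.
Proof.
move=> cg g0; rewrite /rintegrable (supp_restrict g0) -restrict_EFin.
apply/(integrable_mkcond _ _).1 => //.
apply: continuous_compact_integrable; first exact: segment_compact.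
exact: continuous_subspaceT.
Qed.

Lemma bounded_supp g (r : R) : continuous g ->
  (forall x, r < `|x| -> g x = 0) -> exists2 M, 0 <= M & forall x, `|g x| <= M.
Proof.
move=> cg g0.
(* [r] may be negative; the maximum keeps the segment nonempty. *)
have r0 : 0 <= Num.max r 0 by rewrite le_max lexx orbT.
have le : - Num.max r 0 <= Num.max r 0 by rewrite -subr_ge0 opprK addr_ge0.
have cng : {within `[- Num.max r 0, Num.max r 0], continuous (fun x => `|g x|)}.
  apply: continuous_subspaceT => x.
  by apply: (@continuous_comp _ _ _ g (fun y : R => `|y|)); [exact: cg|exact: norm_continuous].
have [c _ Hc] := EVT_max le cng.
exists `|g c| => // x.
have [xr|xr] := leP `|x| (Num.max r 0); first by apply: Hc; rewrite in_itv/= -ler_norml.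
by rewrite g0 ?normr0// (le_lt_trans _ xr)// le_max lexx.
Qed.

Lemma rint_derive g (r : R) : smooth g ->
  (forall x, r < `|x| -> g x = 0) -> rint (derive1 g) = 0.
Proof.
(* Strictly beyond the support, so that [g] vanishes at both end points, and positive, so that the
   segment is nondegenerate. *)
move=> sg g0; set r' := Num.max r 0 + 1.
have r'r : r < r' by rewrite ltr_pwDr// le_max lexx.
have r'0 : 0 < r' by rewrite ltr_pwDr// le_max lexx orbT.
have g0' : forall x, r' < `|x| -> g x = 0 by move=> x ?; rewrite g0// (lt_trans r'r).
have lt : - r' < r' by rewrite -subr_gt0 opprK addr_gt0.
rewrite (supp_restrict (derive1_eq0 g0')) -Rintegral_mkcond /Rintegral.
rewrite (@continuous_FTC2 _ _ g)//.
- by rewrite (g0 r') ?gtr0_norm// (g0 (- r')) ?normrN ?gtr0_norm//= subrr.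
- apply: continuous_subspaceT; exact/smooth_continuous/smooth_derive1.
- split => [x _||]; first exact: smooth_derivable.
  + by apply: cvg_at_right_filter; exact: smooth_continuous.
  + by apply: cvg_at_left_filter; exact: smooth_continuous.
Qed.

End BoundedSupport.

(** * Complex test functions and their derivatives *)

Section TestFunctions.
Variable R : realType.
Local Notation C := R[i].
Implicit Types (phi psi th : R -> C) (O : set R).

Definition csmooth phi := smooth (@cRe R \o phi) /\ smooth (@cIm R \o phi).

Definition supp_in (r : R) phi := forall x, r < `|x| -> phi x = 0.

Definition cderiv phi (x : R) : C :=
  (derive1 (@cRe R \o phi) x +i* derive1 (@cIm R \o phi) x)%C.

Lemma csmoothM phi psi : csmooth phi -> csmooth psi -> csmooth (fun x => phi x * psi x).
Proof.
move=> [f1 f2] [g1 g2]; split.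
  rewrite (_ : _ \o _ = fun x => cRe (phi x) * cRe (psi x) - cIm (phi x) * cIm (psi x)).
    exact: smoothB (smoothM f1 g1) (smoothM f2 g2).
  by apply/funext => x/=; rewrite cReM.
rewrite (_ : _ \o _ = fun x => cRe (phi x) * cIm (psi x) + cIm (phi x) * cRe (psi x)).
  exact: smoothD (smoothM f1 g2) (smoothM f2 g1).
by apply/funext => x/=; rewrite cImM.
Qed.

Lemma csmoothD phi psi : csmooth phi -> csmooth psi -> csmooth (fun x => phi x + psi x).
Proof.
move=> [f1 f2] [g1 g2]; split.
  rewrite (_ : _ \o _ = fun x => cRe (phi x) + cRe (psi x)); first exact: smoothD f1 g1.
  by apply/funext => x/=; rewrite cReD.
rewrite (_ : _ \o _ = fun x => cIm (phi x) + cIm (psi x)); first exact: smoothD f2 g2.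
by apply/funext => x/=; rewrite cImD.
Qed.

Lemma csmooth_cst (c : C) : csmooth (fun=> c).
Proof. by split; exact: smooth_cst. Qed.

Lemma csmooth_real (g : R -> R) : smooth g -> csmooth (fun x => (g x)%:C%C).
Proof. by move=> sg; split; [exact: sg|exact: smooth_cst]. Qed.

Lemma csmooth_affine phi (a b : R) : csmooth phi -> csmooth (fun x => phi (a * x + b)).
Proof.
by move=> [f1 f2]; split; [have := @smooth_affine R _ a b f1|have := @smooth_affine R _ a b f2].
Qed.

Lemma csmooth_expi (a : R) : csmooth (fun x => expi (a * x)).
Proof.
have := @csmooth_affine (@expi R) a 0; under eq_fun do rewrite addr0.
by apply; split; [exact: smooth_cos|exact: smooth_sin].
Qed.

Lemma csmooth_cderiv phi : csmooth phi -> csmooth (cderiv phi).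
Proof. by move=> [f1 f2]; split; exact: smooth_derive1. Qed.

Lemma csmooth_meas phi : csmooth phi -> cmeas phi.
Proof. by move=> [f1 f2]; split; [exact: smooth_meas f1|exact: smooth_meas f2]. Qed.

Lemma cderivM phi psi x : csmooth phi -> csmooth psi ->
  cderiv (fun x => phi x * psi x) x = cderiv phi x * psi x + phi x * cderiv psi x.
Proof.
move=> [f1 f2] [g1 g2].
have df1 := is_derive1 (@smooth_derivable R _ x f1).
have df2 := is_derive1 (@smooth_derivable R _ x f2).
have dg1 := is_derive1 (@smooth_derivable R _ x g1).
have dg2 := is_derive1 (@smooth_derivable R _ x g2).
apply: complex_ext; rewrite ?cReD ?cImD ?cReM ?cImM /=.
  rewrite (_ : _ \o _ = (@cRe R \o phi) * (@cRe R \o psi) - (@cIm R \o phi) * (@cIm R \o psi)).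
    have h := is_deriveB (is_deriveM df1 dg1) (is_deriveM df2 dg2).
    by rewrite derive1E derive_val /cderiv /GRing.scale /=; ring.
  by apply/funext => y/=; rewrite cReM.
rewrite (_ : _ \o _ = (@cRe R \o phi) * (@cIm R \o psi) + (@cIm R \o phi) * (@cRe R \o psi)).
  have h := is_deriveD (is_deriveM df1 dg2) (is_deriveM df2 dg1).
  by rewrite derive1E derive_val /cderiv /GRing.scale /=; ring.
by apply/funext => y/=; rewrite cImM.
Qed.

Lemma cderiv_expi (a x : R) :
  cderiv (fun x => expi (a * x)) x = (0 +i* a)%C * expi (a * x).
Proof.
have dc := @is_derive_comp_affine R (@cos R) a 0 x (@derivable_cos R (a * x + 0)).
have ds := @is_derive_comp_affine R (@sin R) a 0 x (@derivable_sin R (a * x + 0)).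
move: dc ds; under eq_fun do rewrite addr0; move=> dc; under eq_fun do rewrite addr0; move=> ds.
apply: complex_ext; rewrite ?cReM ?cImM /= derive1E derive_val addr0.
  by rewrite (derive1_eq (@is_derive_cos R)) /cRe /cIm /=; ring.
by rewrite (derive1_eq (@is_derive_sin R)) /cRe /cIm /=; ring.
Qed.

Lemma supp_in_cderiv r phi : supp_in r phi -> supp_in r (cderiv phi).
Proof.
move=> p0 x rx; apply: complex_ext => /=; apply: (@derive1_eq0 _ _ r) => // y ry /=;
  by rewrite p0.
Qed.

Lemma supp_in_mull r phi th : supp_in r phi -> supp_in r (fun x => th x * phi x).
Proof. by move=> p0 x rx; rewrite p0 ?mulr0. Qed.

Lemma supp_inRe r phi : supp_in r phi -> forall x, r < `|x| -> (@cRe R \o phi) x = 0.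
Proof. by move=> p0 x rx /=; rewrite p0. Qed.

Lemma supp_inIm r phi : supp_in r phi -> forall x, r < `|x| -> (@cIm R \o phi) x = 0.
Proof. by move=> p0 x rx /=; rewrite p0. Qed.

Lemma cintegrable_supp r phi : csmooth phi -> supp_in r phi -> cintegrable phi.
Proof.
move=> [f1 f2] p0; split.
  exact: rintegrable_supp (smooth_continuous f1) (supp_inRe p0).
exact: rintegrable_supp (smooth_continuous f2) (supp_inIm p0).
Qed.

Lemma cbounded_supp r phi : csmooth phi -> supp_in r phi ->
  exists M, forall x, cabs (phi x) <= M.
Proof.
move=> [f1 f2] p0.
have [M1 _ H1] := bounded_supp (smooth_continuous f1) (supp_inRe p0).
have [M2 _ H2] := bounded_supp (smooth_continuous f2) (supp_inIm p0).
by exists (M1 + M2) => x; rewrite (le_trans (cabs_le _))// lerD ?H1 ?H2.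
Qed.

Lemma cint_cderiv r phi : csmooth phi -> supp_in r phi -> cint (cderiv phi) = 0.
Proof.
move=> [f1 f2] p0; apply: complex_ext => /=.
  exact: rint_derive f1 (supp_inRe p0).
exact: rint_derive f2 (supp_inIm p0).
Qed.

Lemma test_funP O phi : test_fun O phi -> csmooth phi /\ exists r, supp_in r phi.
Proof.
move=> [s1 [s2 [K [/compact_bounded [M [_ HM]] _ p0]]]]; split => //.
exists (M + 1) => x Mx; apply: p0 => Kx.
have M1 : M < M + 1 by rewrite ltrDl.
by have := HM _ M1 x Kx; rewrite /= leNgt Mx.
Qed.

Lemma test_funM O th phi : csmooth th -> test_fun O phi ->
  test_fun O (fun x => th x * phi x).
Proof.
move=> sth [s1 [s2 [K [cK KO p0]]]].
have [? ?] : csmooth (fun x => th x * phi x) by exact: csmoothM sth (conj s1 s2).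
by do 2 split => //; exists K; split => // x Kx; rewrite p0 ?mulr0.
Qed.

Lemma test_funS O O' phi : O `<=` O' -> test_fun O phi -> test_fun O' phi.
Proof.
move=> OO [s1 [s2 [K [cK KO p0]]]]; do 2 split => //.
by exists K; split => // x /KO /OO.
Qed.

End TestFunctions.

Local Opaque ComplexField.mulc ComplexField.addc.

(** * The Fourier transform of test functions *)

Section IntegralTools.
Variable R : realType.
Local Notation C := R[i].
Let mu := @lebesgue_measure R.
Local Notation rint := (Rintegral mu setT).

Lemma cRe_cint (g : R -> C) : cRe (cint g) = rint (@cRe R \o g).
Proof. by []. Qed.

Lemma cIm_cint (g : R -> C) : cIm (cint g) = rint (@cIm R \o g).
Proof. by []. Qed.

Lemma EFin_rint (G : R -> R) : rintegrable G ->
  (rint G)%:E = (\int[mu]_x (G x)%:E)%E.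
Proof. by move=> iG; rewrite /Rintegral fineK//; exact: integrable_fin_num. Qed.

(** Tonelli's criterion: the majorant [H] makes the inner integrals of [|f|] finite, and [K] makes
    the outer one finite. *)
Lemma prod_integrable (f : R -> R -> R) (H : R -> R -> R) (K : R -> R) :
  measurable_fun setT (fun z : R * R => f z.1 z.2) ->
  (forall x, rintegrable (H x)) -> (forall x y, `|f x y| <= H x y) ->
  rintegrable K -> (forall x, rint (H x) <= K x) ->
  (mu \x mu)%E.-integrable setT (fun z : R * R => (f z.1 z.2)%:E).
Proof.
move=> mf iH fH iK HK; have /measurable_EFinP mf' := mf.
apply/integrable12ltyP => //.
have iK' := integrableP _ _ _ iK; case: iK' => mK; apply: le_lt_trans.
have mabs : measurable_fun setT (fun z : R * R => `|(f z.1 z.2)%:E|%E).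
  exact: (measurableT_comp (@abse_measurable R setT) mf').
apply: ge0_le_integral => //=.
- by move=> x _; exact: integral_ge0.
- exact: (measurable_fun_fubini_tonelli_F (m2 := mu) _ mabs).
- exact: (measurableT_comp (@abse_measurable R setT) mK).
move=> x _.
have mfx : measurable_fun setT (f x).
  exact: (measurableT_comp mf (measurable_pair1 x)).
have ifx : rintegrable (fun y => `|f x y|).
  by apply: rintegrable_norm; exact: rintegrable_le (iH x) (fH x).
rewrite (_ : (\int[mu]_y _)%E = (rint (fun y => `|f x y|))%:E); last first.
  by rewrite EFin_rint.
rewrite lee_fin (le_trans _ (ler_norm _))// (le_trans _ (HK x))//.
exact: le_rint.
Qed.

(** Integrability on the plane controls only almost every section. Asking it of every section makes
    the real-valued inner integrals equal to the extended ones everywhere. *)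
Lemma rFubini (f : R -> R -> R) :
  (mu \x mu)%E.-integrable setT (fun z : R * R => (f z.1 z.2)%:E) ->
  (forall x, rintegrable (f x)) -> (forall y, rintegrable (f ^~ y)) ->
  [/\ rintegrable (fun x => rint (f x)), rintegrable (fun y => rint (f ^~ y)) &
    rint (fun x => rint (f x)) = rint (fun y => rint (f ^~ y))].
Proof.
move=> ifp i1 i2; split.
- have := integrable_fubini_F ifp; rewrite /fubini_F; apply: eq_integrable => // x _ /=.
  by rewrite EFin_rint.
- have mf := measurable_int _ ifp.
  have mG : measurable_fun setT (EFin \o (fun y => rint (f ^~ y))).
    apply: eq_measurable_fun (measurable_fubini_G ifp) => y _ /=.
    by rewrite /fubini_G EFin_rint.
  apply/integrableP; split => //.
  apply: le_lt_trans ((integrable21ltyP _ _ mf).1 ifp).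
  have mabs : measurable_fun setT (fun z : R * R => `|(f z.1 z.2)%:E|%E).
    exact: (measurableT_comp (@abse_measurable R setT) mf).
  apply: ge0_le_integral => //=.
  + exact: (measurableT_comp (@abse_measurable R setT) mG).
  + exact: (measurable_fun_fubini_tonelli_G (m1 := mu) _ mabs).
  + move=> y _; rewrite (_ : (\int[mu]_x _)%E = (rint (fun x => `|f x y|))%:E).
      by rewrite lee_fin; exact: (le_normr_Rintegral measurableT (i2 y)).
    by rewrite EFin_rint//; exact: rintegrable_norm.
- rewrite /Rintegral; congr fine.
  transitivity (\int[mu]_x \int[mu]_y (f x y)%:E)%E.
    by apply: eq_integral => x _; rewrite -EFin_rint.
  rewrite (Fubini ifp); apply: eq_integral => y _.
  exact/esym/(EFin_rint (i2 y)).
Qed.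

Lemma cFubini (f : R -> R -> C) (H : R -> R -> R) (K : R -> R) :
  cmeas (fun z : R * R => f z.1 z.2) ->
  (forall x, rintegrable (H x)) -> (forall x y, cabs (f x y) <= H x y) ->
  rintegrable K -> (forall x, rint (H x) <= K x) ->
  (forall y, cintegrable (f ^~ y)) ->
  cintegrable (fun x => cint (f x)) /\
  cint (fun x => cint (f x)) = cint (fun y => cint (f ^~ y)).
Proof.
move=> [m1 m2] iH fH iK HK i2.
have i1 x : cintegrable (f x).
  apply: cintegrable_le (iH x) (fH x).
  by split; [exact: (measurableT_comp m1 (measurable_pair1 x))|
    exact: (measurableT_comp m2 (measurable_pair1 x))].
have p1 : (mu \x mu)%E.-integrable setT (fun z : R * R => (cRe (f z.1 z.2))%:E).
  apply: (prod_integrable (f := fun x y => cRe (f x y)) _ iH _ iK HK) => // x y.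
  exact: le_trans (normr_cRe _) (fH _ _).
have p2 : (mu \x mu)%E.-integrable setT (fun z : R * R => (cIm (f z.1 z.2))%:E).
  apply: (prod_integrable (f := fun x y => cIm (f x y)) _ iH _ iK HK) => // x y.
  exact: le_trans (normr_cIm _) (fH _ _).
have [a1 b1 c1] := rFubini p1 (fun x => (i1 x).1) (fun x => (i2 x).1).
have [a2 b2 c2] := rFubini p2 (fun x => (i1 x).2) (fun x => (i2 x).2).
by split; [split|apply: complex_ext].
Qed.

(** Real dominated convergence for [cabs (g_ n x - g x)], with majorant [H + H]. Stating convergence
    through moduli keeps every limit in [R]. *)
Lemma cint_dominated (g_ : nat -> R -> C) (g : R -> C) (H : R -> R) :
  (forall n, cmeas (g_ n)) -> cmeas g -> rintegrable H ->
  (forall n x, cabs (g_ n x) <= H x) -> (forall x, cabs (g x) <= H x) ->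
  (forall x, (fun n => cabs (g_ n x - g x)) @ \oo --> (0 : R)) ->
  (fun n => cabs (cint (g_ n) - cint g)) @ \oo --> (0 : R).
Proof.
move=> mg_ mg iH gH_ gH gg.
have mD n : cmeas (fun x => g_ n x - g x).
  have := cmeasD (mg_ n) (cmeasM (cmeas_cst _ (-1)) mg).
  by under eq_fun do rewrite mulN1r.
have dH n x : cabs (g_ n x - g x) <= H x + H x.
  by rewrite (le_trans (cabsD _ _))// cabsN lerD.
have iHH := rintegrableD iH iH.
have id n : rintegrable (fun x => cabs (g_ n x - g x)).
  apply: rintegrable_le iHH _; first exact: measurable_cabs (mD n).
  by move=> x; rewrite ger0_norm ?cabs_ge0.
have [_ _ /fine_cvg /= cv] : [/\ mu.-integrable setT (fun=> 0%E : \bar R), True &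
    (\int[mu]_x (cabs (g_ n x - g x))%:E)%E @[n --> \oo] --> 0%:E].
  have [|||||? _ h] := @dominated_convergence _ _ _ mu setT measurableT
    (fun n x => (cabs (g_ n x - g x))%:E) (fun=> 0%E) (fun x => (H x + H x)%:E).
  - by move=> n; apply/measurable_EFinP; exact: measurable_cabs (mD n).
  - exact: measurable_cst.
  - by apply: aeW => x _; apply: cvg_EFin; [exact: nearW|exact: gg].
  - exact: iHH.
  - by apply: aeW => x n _; rewrite /= lee_fin ger0_norm ?cabs_ge0.
  split => //; rewrite (_ : 0%:E = \int[mu]_(x in setT) (fun=> 0%E) x)%E//.
  by rewrite integral0.
apply: (@squeeze_cvgr _ _ _ _ (fun=> 0) (fun n => 2 * rint (fun x => cabs (g_ n x - g x)))).
- apply: nearW => n; rewrite cabs_ge0 /=.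
  have ig : cintegrable g by exact: cintegrable_le mg iH gH.
  have ign : cintegrable (g_ n) by exact: cintegrable_le (mg_ n) iH (gH_ n).
  have -> : cint (g_ n) - cint g = cint (fun x => g_ n x - g x).
    rewrite -[X in _ + X]mulN1r -cintZ// -cintD//; last exact: cintegrableZ.
    by congr cint; apply/funext => x; rewrite mulN1r.
  apply: cabs_cint => //; apply: cintegrable_le (mD n) iHH (dH n).
- exact: cvg_cst.
- rewrite -[X in _ --> X](mulr0 2); apply: cvgMr; exact: cv.
Qed.

(** A positive value at [x] persists, up to a factor 1/2, on an interval around [x], which would
    make the integral positive. *)
Lemma continuous_rint_eq0 (G : R -> R) : continuous G -> rintegrable G ->
  (forall x, 0 <= G x) -> rint G = 0 -> forall x, G x = 0.
Proof.
move=> cG iG G0 iG0 x; apply/eqP; apply: contraT => Gx.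
have Gx0 : 0 < G x by rewrite lt_neqAle eq_sym Gx G0.
have /nbhs_ballP[d /= d0 Hd] : nbhs x [set y | G x / 2 < G y].
  apply: (@cvgr_gt _ _ (nbhs x) _ G (G x) (cG x)).
  by rewrite ltr_pdivrMr// ltr_pMr// ltr1n.
pose I : set R := `]x - d, x + d[.
have iI : rintegrable (\1_I : R -> R) by exact: integrable_indic_itv.
suff : 0 < rint G by rewrite iG0 ltxx.
apply: (@lt_le_trans _ _ (rint (fun y => G x / 2 * \1_I y))).
  have xd : x - d < x + d by rewrite ltrD2l gtrN.
  have mI : mu I = (x + d - (x - d))%:E.
    by rewrite /mu /I lebesgue_measure_itv/= lte_fin xd.
  have E : rint (\1_I : R -> R) = fine (mu I).
    have mmI : measurable I by exact: measurable_itv.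
    by have := integral_indic mu measurableT mmI; rewrite setIT /Rintegral => ->.
  by rewrite RintegralZl// mulr_gt0 ?divr_gt0// E mI/= subr_gt0.
apply: le_rint => // [|y]; first exact: rintegrableZ.
rewrite indicE; have [/set_mem|] := boolP (y \in I); last by rewrite mulr0.
rewrite /I /= in_itv/= => yI; rewrite mulr1 ltW// Hd// /ball/= ltr_distlC.
by case/andP: yI => y1 y2; apply/andP; split.
Qed.

End IntegralTools.

Local Opaque cint.

(** * Decay, continuity and the multiplication formula *)

Section Fourier.
Variable R : realType.
Local Notation C := R[i].
Let mu := @lebesgue_measure R.
Local Notation rint := (Rintegral mu setT).
Implicit Types (phi psi th : R -> C).

Lemma cmeas_character (t : R) : cmeas (fun x : R => expi (- (t * x))).
Proof.
have := csmooth_meas (@csmooth_expi R (- t)).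
by under eq_fun do rewrite mulNr.
Qed.

Lemma cintegrable_character phi (t : R) : cintegrable phi ->
  cintegrable (fun x => expi (- (t * x)) * phi x).
Proof.
move=> iphi; apply: (cintegrableM (M := 1)) => //; first exact: cmeas_character.
by move=> x; rewrite cabs_expi.
Qed.

Lemma cabs_fourier phi (t : R) : cintegrable phi ->
  cabs (fourier phi t) <= 2 * rint (fun x => cabs (phi x)).
Proof.
move=> iphi; apply: cabs_cint.
- exact: cintegrable_character.
- exact: cintegrable_cabs.
- by move=> x; rewrite cabsM cabs_expi mul1r.
Qed.

Lemma fourierD phi psi t : cintegrable phi -> cintegrable psi ->
  fourier (fun x => phi x + psi x) t = fourier phi t + fourier psi t.
Proof.
move=> i1 i2; rewrite /fourier -cintD; [|exact: cintegrable_character..].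
by congr cint; apply/funext => x; rewrite mulrDr.
Qed.

Lemma fourierZ (c : C) phi t : cintegrable phi ->
  fourier (fun x => c * phi x) t = c * fourier phi t.
Proof.
move=> i1; rewrite /fourier -cintZ; last exact: cintegrable_character.
by congr cint; apply/funext => x; rewrite mulrCA.
Qed.

(** Integration by parts: the derivative of [expi (- (t * x)) * phi x] has integral zero. *)
Lemma fourier_cderiv r phi t : csmooth phi -> supp_in r phi ->
  fourier (cderiv phi) t = (0 +i* t)%C * fourier phi t.
Proof.
move=> sp p0.
have E x : expi (- (t * x)) = expi ((- t) * x) by rewrite mulNr.
have := cint_cderiv (csmoothM (csmooth_expi (- t)) sp) (supp_in_mull _ p0).
have -> : cderiv (fun x => expi (- t * x) * phi x) =
    (fun x => expi (- (t * x)) * cderiv phi x +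
      (- (0 +i* t)%C) * (expi (- (t * x)) * phi x)).
  apply/funext => x; rewrite (cderivM x (csmooth_expi (- t)) sp).
  rewrite cderiv_expi E addrC; congr (_ + _); rewrite -mulrA; congr (_ * _).
  by apply: complex_ext; rewrite /cRe /cIm /= ?oppr0.
have ip := cintegrable_supp sp p0.
have idp := cintegrable_supp (csmooth_cderiv sp) (supp_in_cderiv p0).
rewrite cintD; [|exact: cintegrable_character|exact/cintegrableZ/cintegrable_character].
rewrite cintZ; last exact: cintegrable_character.
by rewrite mulNr => /eqP; rewrite subr_eq0 => /eqP.
Qed.

(** [1 + t ^+ 2] times the transform of [phi] is the transform of [phi] minus its second derivative,
    hence bounded. *)
Lemma fourier_decay r phi : csmooth phi -> supp_in r phi ->
  exists M, forall t, cabs (fourier phi t) <= M * (1 + t ^+ 2)^-1.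
Proof.
move=> sp p0.
have ip := cintegrable_supp sp p0.
have sdp := csmooth_cderiv sp; have dp0 := supp_in_cderiv p0.
have sddp := csmooth_cderiv sdp; have ddp0 := supp_in_cderiv dp0.
have iddp := cintegrable_supp sddp ddp0.
exists (2 * rint (fun x => cabs (phi x)) + 2 * rint (fun x => cabs (cderiv (cderiv phi) x))) => t.
have t0 : 0 < 1 + t ^+ 2 by rewrite ltr_pwDl// sqr_ge0.
rewrite ler_pdivlMr// -[X in _ * X](ger0_norm (ltW t0)) -cabs_real -cabsM.
have -> : fourier phi t * (1 + t ^+ 2)%:C%C = fourier phi t + (- 1) * fourier (cderiv (cderiv phi)) t.
  rewrite (fourier_cderiv _ sdp dp0) (fourier_cderiv _ sp p0).
  by apply: complex_ext; rewrite ?(cReM, cImM, cReD, cImD) /cRe /cIm /= ; ring.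
rewrite (le_trans (cabsD _ _))// mulN1r cabsN lerD//; exact: cabs_fourier.
Qed.

(** The mean value theorem is applied to cosine and sine separately, hence the 2. *)
Lemma expi_lipschitz (a b : R) : cabs (expi a - expi b) <= 2 * `|a - b|.
Proof.
have lip (f f' : R -> R) : (forall x : R, is_derive x 1 f (f' x)) ->
    (forall x, `|f' x| <= 1) -> forall a b : R, `|f a - f b| <= `|a - b|.
  move=> df f1.
  have cf : continuous f.
    move=> x; apply/differentiable_continuous/derivable1_diffP.
    by have := df x => -[].
  suff H u v : u <= v -> `|f v - f u| <= `|v - u|.
    move=> u v; have [uv|/ltW vu] := leP u v; last exact: H.
    by rewrite distrC [leRHS]distrC; exact: H.
  move=> uv; have [|c _ ->] := @MVT_segment R f f' u v uv.
    exact: continuous_subspaceT.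
  by rewrite normrM ler_piMl.
rewrite (le_trans (cabs_le _))// mulr_natl mulr2n lerD//.
  have -> : cRe (expi a - expi b) = cos a - cos b by [].
  apply: (lip _ (fun x => - sin x)) => x.
  by rewrite normrN ler_norml sin_geN1 sin_le1.
have -> : cIm (expi a - expi b) = sin a - sin b by [].
apply: (lip _ (@cos R)) => x.
by rewrite ler_norml cos_geN1 cos_le1.
Qed.

Lemma fourier_lipschitz r phi : csmooth phi -> supp_in r phi ->
  exists2 L, 0 <= L & forall s t, cabs (fourier phi s - fourier phi t) <= L * `|s - t|.
Proof.
move=> sp p0.
have ip := cintegrable_supp sp p0.
have ixp : cintegrable (fun x => x%:C%C * phi x).
  apply: (@cintegrable_supp _ r); last exact: supp_in_mull.
  exact: csmoothM (csmooth_real (@smooth_id R)) sp.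
have ix := cintegrable_cabs ixp.
(* A first moment of [phi]; one factor 2 comes from [cabs_cint], the other from [expi_lipschitz]. *)
exists (4 * rint (fun x => cabs (x%:C%C * phi x))).
  by rewrite mulr_ge0// rint_ge0// => x; exact: cabs_ge0.
move=> s t.
have -> : fourier phi s - fourier phi t =
    cint (fun x => (expi (- (s * x)) - expi (- (t * x))) * phi x).
  rewrite /fourier -[X in _ + X]mulN1r -cintZ; last exact: cintegrable_character.
  rewrite -cintD; [|exact: cintegrable_character|exact/cintegrableZ/cintegrable_character].
  by congr cint; apply/funext => x; rewrite mulN1r mulrBl.
have ->: 4 * rint (fun x => cabs (x%:C%C * phi x)) * `|s - t| =
    2 * rint (fun x => 2 * `|s - t| * cabs (x%:C%C * phi x)).
  by rewrite RintegralZl//; ring.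
apply: cabs_cint.
- have := cintegrableD (cintegrable_character s ip)
    (cintegrableZ (-1) (cintegrable_character t ip)).
  by under eq_fun do rewrite mulN1r -mulrBl.
- exact: rintegrableZ.
- move=> x; rewrite !cabsM cabs_real mulrA ler_wpM2r ?cabs_ge0//.
  rewrite (le_trans (expi_lipschitz _ _))// -mulrA ler_wpM2l// -normrM.
  by rewrite -opprD normrN -mulNr -mulrDl.
Qed.

Lemma fourier_continuous r phi : csmooth phi -> supp_in r phi ->
  continuous (@cRe R \o fourier phi) /\ continuous (@cIm R \o fourier phi).
Proof.
move=> sp p0; have [L L0 HL] := fourier_lipschitz sp p0.
have cont (G : R -> R) : (forall s t, `|G s - G t| <= L * `|s - t|) -> continuous G.
  move=> GL x; apply/cvgrPdist_lt => e e0.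
  have d0 : 0 < e / (L + 1) by rewrite divr_gt0// ltr_wpDl.
  near=> y; apply: le_lt_trans (GL _ _) _.
  have : `|x - y| < e / (L + 1) by near: y; exact: cvgr_dist_lt.
  rewrite ltr_pdivlMr ?ltr_wpDl// => /(le_lt_trans _); apply.
  by rewrite mulrC ler_wpM2l// lerDl.
split; apply: cont => s t.
  have -> : (@cRe R \o fourier phi) s - (@cRe R \o fourier phi) t = cRe (fourier phi s - fourier phi t).
    by rewrite cReD; congr (_ + _); case: (fourier phi t).
  exact: le_trans (normr_cRe _) (HL _ _).
have -> : (@cIm R \o fourier phi) s - (@cIm R \o fourier phi) t = cIm (fourier phi s - fourier phi t).
  by rewrite cImD; congr (_ + _); case: (fourier phi t).
exact: le_trans (normr_cIm _) (HL _ _).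
Unshelve. all: by end_near. Qed.

Lemma fourier_meas r phi : csmooth phi -> supp_in r phi -> cmeas (fourier phi).
Proof.
move=> sp p0; have [c1 c2] := fourier_continuous sp p0.
by split; apply: continuous_measurable_fun.
Qed.

Lemma fourier_integrable r phi : csmooth phi -> supp_in r phi ->
  cintegrable (fourier phi).
Proof.
move=> sp p0; have [M HM] := fourier_decay sp p0.
exact: cintegrable_le (fourier_meas sp p0)
  (rintegrableZ M (@rintegrable_oneDsqrV R)) HM.
Qed.

Lemma fourier_affine phi (a b t : R) : 0 < a -> cintegrable phi ->
  fourier (fun x => phi (a * x + b)) t =
  (a^-1)%:C%C * expi (t * b / a) * fourier phi (t / a).
Proof.
move=> a0 ip; have an0 := lt0r_neq0 a0.
rewrite {1}/fourier (@cint_affine R a^-1 (- b / a)) ?invr_gt0//; last first.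
  apply: cintegrable_meas; apply: cintegrable_character.
  exact: cintegrable_affine.
rewrite -mulrA; congr (_ * _); rewrite /fourier -cintZ; last exact: cintegrable_character.
congr cint; apply/funext => x; rewrite mulrA -expiD; congr (expi _ * phi _); by field.
Qed.

Lemma fourier_modulate phi (l t : R) :
  fourier (fun x => expi (- (l * x)) * phi x) t = fourier phi (t + l).
Proof.
congr cint; apply/funext => x; rewrite mulrA -expiD; congr (expi _ * _).
by rewrite mulrDl opprD.
Qed.

(* Both sides are the integral of [phi t * expi (- (t * x)) * psi x] over the plane. *)
Lemma multiplication_formula phi psi : cintegrable phi -> cintegrable psi ->
  cint (fun t => phi t * fourier psi t) = cint (fun x => fourier phi x * psi x).
Proof.
move=> ip iq.
have mp := cintegrable_meas ip; have ms := cintegrable_meas iq.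
have [_ E] : cintegrable (fun t => cint (fun x => phi t * (expi (- (t * x)) * psi x))) /\
  cint (fun t => cint (fun x => phi t * (expi (- (t * x)) * psi x))) =
  cint (fun x => cint (fun t => phi t * (expi (- (t * x)) * psi x))).
  apply: (@cFubini R _ (fun t x => cabs (phi t) * cabs (psi x))
    (fun t => cabs (phi t) * rint (fun x => cabs (psi x)))).
  - apply: cmeasM; first exact: cmeas_comp measurable_fst mp.
    apply: cmeasM; last exact: cmeas_comp measurable_snd ms.
    apply: cmeas_expi; apply: measurable_funN; apply: measurable_funM;
      [exact: measurable_fst|exact: measurable_snd].
  - by move=> t; apply: rintegrableZ; exact: cintegrable_cabs.
  - by move=> t x; rewrite !cabsM cabs_expi mul1r.
  - by under eq_fun do rewrite mulrC; apply: rintegrableZ; exact: cintegrable_cabs.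
  - by move=> t; rewrite RintegralZl//; exact: cintegrable_cabs.
  - move=> x; rewrite (_ : (fun t => _) = fun t => psi x * (expi (- (x * t)) * phi t)).
      exact/cintegrableZ/cintegrable_character.
    by apply/funext => t; rewrite (mulrC t x); ring.
transitivity (cint (fun t => cint (fun x => phi t * (expi (- (t * x)) * psi x)))).
  congr cint; apply/funext => t.
  by rewrite (cintZ _ (cintegrable_character t iq)).
rewrite E; congr cint; apply/funext => x.
rewrite mulrC -cintZ; last exact: cintegrable_character.
by congr cint; apply/funext => t; rewrite (mulrC t x); ring.
Qed.

(* [psi] regularizes: test the multiplication formula against [psi (x / A)] and let
   [A] go to infinity. *)
Lemma fourier_integral_ratio r s phi psi : csmooth phi -> supp_in r phi ->
  csmooth psi -> supp_in s psi ->
  psi 0 * cint (fourier phi) = phi 0 * cint (fourier psi).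
Proof.
move=> sp p0 ss s0.
have ip := cintegrable_supp sp p0; have iq := cintegrable_supp ss s0.
have ifp := fourier_integrable sp p0; have ifs := fourier_integrable ss s0.
have [Mp HMp] := cbounded_supp sp p0; have [Ms HMs] := cbounded_supp ss s0.
have An (n : nat) : 0 < n.+1%:R^-1 :> R by rewrite invr_gt0.
(* With A = n + 1, the transform of psi(x / A) at t is A times that of psi at A t; the substitution
   t = x / A then moves the dilation onto [phi]. *)
have scaled n : cint (fun x => fourier phi x * psi (n.+1%:R^-1 * x)) =
    cint (fun x => fourier psi x * phi (n.+1%:R^-1 * x)).
  have aff (g : R -> C) : (fun x => g (n.+1%:R^-1 * x)) = fun x => g (n.+1%:R^-1 * x + 0).
    by apply/funext => x; rewrite addr0.
  have isn : cintegrable (fun x => psi (n.+1%:R^-1 * x)).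
    by rewrite aff; exact: cintegrable_affine.
  rewrite -(multiplication_formula ip isn) aff.
  under eq_fun do rewrite fourier_affine// mulr0 mul0r expi0 mulr1 invrK.
  rewrite (@cint_affine R n.+1%:R^-1 0) //; last first.
    apply: cmeasM; first exact: cintegrable_meas.
    apply: cmeasM; first exact: cmeas_cst.
    apply: (cmeas_comp (k := fun x : R => x * n.+1%:R)); first exact: measurable_funM.
    exact: cintegrable_meas.
  rewrite -cintZ.
    congr cint; apply/funext => x; rewrite addr0 mulrAC mulVf// mul1r.
    rewrite mulrA mulrA [X in X * fourier _ _]mulrAC -rmorphM/= mulVf// mul1r.
    by rewrite mulrC.
  rewrite (_ : (fun x => _) = fun x => (n.+1%:R)%:C%C * (phi (n.+1%:R^-1 * x + 0) * fourier psi x)).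
    apply: cintegrableZ; apply: (cintegrableM (M := Mp)) => //.
    exact: (csmooth_meas (csmooth_affine _ _ sp)).
  by apply/funext => x; rewrite mulrCA addr0 mulrAC mulVf// mul1r.
(* The integrands are dominated by [M * cabs (g x)], and h(x / A) tends to h(0) by continuity at the
   origin. *)
have lim (g h : R -> C) M : cintegrable g -> csmooth h -> (forall x, cabs (h x) <= M) ->
    (fun n => cabs (cint (fun x => g x * h (n.+1%:R^-1 * x)) - h 0 * cint g)) @ \oo --> (0 : R).
  move=> ig sh hM.
  have -> : h 0 * cint g = cint (fun x => g x * h 0).
    by rewrite -cintZ//; congr cint; apply/funext => x; rewrite mulrC.
  have mg := cintegrable_meas ig.
  apply: (@cint_dominated R _ _ (fun x => M * cabs (g x))).
  - move=> n; apply: cmeasM => //.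
    have := csmooth_meas (csmooth_affine n.+1%:R^-1 0 sh).
    by under eq_fun do rewrite addr0.
  - by apply: cmeasM => //; exact: cmeas_cst.
  - exact/rintegrableZ/cintegrable_cabs.
  - by move=> n x; rewrite cabsM mulrC ler_wpM2r ?cabs_ge0.
  - by move=> x; rewrite cabsM mulrC ler_wpM2r ?cabs_ge0.
  - move=> x.
    have cv (u : R -> R) : continuous u ->
        (fun n => `|u (n.+1%:R^-1 * x) - u 0|) @ \oo --> (0 : R).
      move=> cu; rewrite -[X in _ --> X](normr0 R); apply: cvg_norm.
      rewrite -[X in _ --> X](subrr (u 0)); apply: cvgB; last exact: cvg_cst.
      have cx : (n.+1%:R^-1 * x) @[n --> \oo] --> (0 : R).
        by rewrite -[X in _ --> X](mul0r x); apply: cvgMl; exact: cvg_harmonic.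
      exact: (cvg_comp _ _ cx (cu 0)).
    have h1 := cv _ (smooth_continuous sh.1); have h2 := cv _ (smooth_continuous sh.2).
    apply: (@squeeze_cvgr _ _ _ _ (fun=> 0)
      (fun n => cabs (g x) * (`|cRe (h (n.+1%:R^-1 * x)) - cRe (h 0)| +
         `|cIm (h (n.+1%:R^-1 * x)) - cIm (h 0)|))).
    + apply: nearW => n; rewrite cabs_ge0/= -mulrBr cabsM ler_wpM2l ?cabs_ge0//.
      by rewrite (le_trans (cabs_le _))// cReD cImD cReN cImN.
    + exact: cvg_cst.
    + rewrite -[X in _ --> X](mulr0 (cabs (g x))); apply: cvgMr.
      by rewrite -[X in _ --> X](addr0 0); apply: cvgD.
have l1 := lim _ _ _ ifp ss HMs; have l2 := lim _ _ _ ifs sp HMp.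
apply/eqP; rewrite -subr_eq0; apply/eqP/cabs_eq0/eqP; rewrite eq_le cabs_ge0 andbT.
have := cvgD l1 l2; rewrite addr0 => /(_ _) l12.
apply: (ler_cvg_to (cvg_cst (cabs (psi 0 * cint (fourier phi) - phi 0 * cint (fourier psi)))) l12).
apply: nearW => n.
(* By [scaled], this one number approximates both sides. *)
pose a := cint (fun x => fourier phi x * psi (n.+1%:R^-1 * x)).
apply: (@le_trans _ _ (cabs (a - psi 0 * cint (fourier phi)) + cabs (a - phi 0 * cint (fourier psi)))).
  exact: cabsB_triangle.
by rewrite {2}/a scaled.
Qed.

End Fourier.

Local Opaque cabs.

(** * Fourier inversion, the norm A, pairings with bounded functions *)

Section Inversion.
Variable R : realType.
Local Notation C := R[i].
Let mu := @lebesgue_measure R.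
Local Notation rint := (Rintegral mu setT).
Implicit Types (phi psi th : R -> C).

Lemma cintegrable_conjc (g : R -> C) : cintegrable g ->
  cintegrable (fun x => conjc (g x)).
Proof.
move=> [g1 g2]; split.
  by rewrite (_ : _ \o _ = @cRe R \o g)//; apply/funext => x /=; case: (g x).
rewrite (_ : _ \o _ = fun x => (-1) * cIm (g x)); first exact: rintegrableZ.
by apply/funext => x /=; rewrite mulN1r; case: (g x).
Qed.

Lemma cint_conjc (g : R -> C) : cintegrable g ->
  cint (fun x => conjc (g x)) = conjc (cint g).
Proof.
have conjRI z : cRe (conjc z) = cRe z /\ cIm (conjc z) = - cIm z :> R by case: z.
move=> [g1 g2]; apply: complex_ext;
  rewrite ?(conjRI _).1 ?(conjRI _).2 ?cRe_cint ?cIm_cint.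
  by congr Rintegral; apply/funext => x /=; case: (g x).
rewrite -mulN1r -(rintZ _ g2); congr Rintegral.
by apply/funext => x /=; rewrite mulN1r; case: (g x).
Qed.

Definition inversion_constant (c : C) := forall r phi, csmooth phi -> supp_in r phi ->
  forall s, cint (fun x => expi (s * x) * fourier phi x) = c * phi s.

(* The constant is [2 * pi], but only [c != 0] matters.  If [c = 0] then Plancherel's
   identity [int |k^|^2 = c * int |k|^2] would force [k^ = 0], hence [int k = 0]. *)
Lemma inversion_constant_exists (b : R -> R) (r : R) : smooth b ->
  (forall x, r < `|x| -> b x = 0) -> (forall x, 0 <= b x) -> b 0 = 1 ->
  exists c, c != 0 /\ inversion_constant c.
Proof.
move=> sb b0 bge0 b1; pose k x : C := (b x)%:C%C.
have sk : csmooth k by exact: csmooth_real.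
have k0 : supp_in r k by move=> x rx; rewrite /k b0.
have ik := cintegrable_supp sk k0; have ifk := fourier_integrable sk k0.
pose c := cint (fourier k); exists c.
have inv : inversion_constant c.
  move=> s phi sp p0 t; have ip := cintegrable_supp sp p0.
  have sp1 : csmooth (fun x => phi (1 * x + t)) by exact: csmooth_affine.
  have p1 : supp_in (s + `|t|) (fun x => phi (1 * x + t)).
    move=> x; rewrite mul1r => sx; apply: p0.
    by rewrite -(ltrD2r `|t|) (lt_le_trans sx)// -{1}(addrK t x) ler_normB.
  (* Translation by [t] turns the ratio at the origin into inversion at [t]; [k 0 = 1] fixes the
     constant. *)
  have := fourier_integral_ratio sp1 p1 sk k0.
  rewrite mulr0 add0r {1}/k b1 mul1r mulrC -/c => <-.
  congr cint; apply/funext => x.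
  by rewrite (fourier_affine _ _ ltr01 ip) invr1 !mulr1 mul1r (mulrC t).
split => //; apply/negP => /eqP c0.
pose psi x := conjc (fourier k x).
have ipsi : cintegrable psi by exact: cintegrable_conjc.
(* The transform of the conjugate of [fourier k] is the conjugate of the inversion integral of [k],
   that is, of [c * k t]. *)
have fpsi t : fourier psi t = 0.
  transitivity (cint (fun x => conjc (expi (t * x) * fourier k x))).
    congr cint; apply/funext => x; rewrite rmorphM/=; congr (_ * _).
    by rewrite /expi cosN sinN.
  rewrite cint_conjc.
    by rewrite (inv _ _ sk k0) c0 mul0r conjc0.
  have := cintegrable_character (- t) ifk.
  by under eq_fun do rewrite mulNr opprK.
have := multiplication_formula ik ipsi.
under eq_fun do rewrite fpsi mulr0; rewrite cint0 => /esym /(congr1 (@cRe R)).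
rewrite cRe_cint => E.
have [c1 c2] := fourier_continuous sk k0.
pose G x := cRe (fourier k x) * cRe (fourier k x) + cIm (fourier k x) * cIm (fourier k x).
have EG x : cRe (fourier k x * psi x) = G x.
  by rewrite /psi cReM /G; case: (fourier k x) => u v /=; rewrite /cRe /cIm /= mulrN opprK.
have iG : rintegrable G.
  have [Mk HMk] : exists M, forall x, cabs (fourier k x) <= M.
    by exists (2 * rint (fun x => cabs (k x))) => x; exact: cabs_fourier.
  have [h _] : cintegrable (fun x => fourier k x * psi x).
    exact: cintegrableM (cintegrable_meas ifk) HMk ipsi.
  by move: h; congr rintegrable; apply/funext => x; exact: EG.
have G0 : forall x, G x = 0.
  apply: continuous_rint_eq0 => //.
  - by move=> x; apply: cvgD; apply: cvgM; [exact: c1|exact: c1|exact: c2|exact: c2].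
  - by move=> x; rewrite addr_ge0// -expr2 sqr_ge0.
  - by rewrite -[RHS]E; congr Rintegral; apply/funext => x; rewrite /= -EG.
have : cRe (fourier k 0) = 0.
  by have /eqP := G0 0; rewrite /G -!expr2 paddr_eq0 ?sqr_ge0// !sqrf_eq0 => /andP[/eqP].
rewrite /fourier.
have -> : (fun x : R => expi (- (0 * x)) * k x) = k.
  by apply/funext => x; rewrite mul0r oppr0 expi0 mul1r.
move=> ib0.
have := @continuous_rint_eq0 R b (smooth_continuous sb) ik.1 bge0 ib0 0.
by rewrite b1 => /eqP; rewrite oner_eq0.
Qed.

Lemma rintegrable_subr (x : R) (G : R -> R) : rintegrable G ->
  rintegrable (fun y => G (x - y)).
Proof.
move=> iG; have := rintegrable_opp (rintegrable_affine x ltr01 iG).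
by under eq_fun do rewrite mul1r addrC.
Qed.

Lemma rint_subr (x : R) (G : R -> R) : measurable_fun setT G ->
  rint (fun y => G (x - y)) = rint G.
Proof.
move=> mG; rewrite (rint_affine x ltr01 mG) mul1r rint_opp.
  by congr Rintegral; apply/funext => y; rewrite mul1r addrC.
exact: measurableT_comp mG (measurable_affine 1 x).
Qed.

Lemma rint_shift (x : R) (G : R -> R) : measurable_fun setT G ->
  rint (fun y => G (y + x)) = rint G.
Proof.
move=> mG; rewrite (rint_affine x ltr01 mG) mul1r.
by congr Rintegral; apply/funext => y; rewrite mul1r.
Qed.

Lemma cintegrable_sub (x : R) (g : R -> C) : cintegrable g ->
  cintegrable (fun y => g (x - y)).
Proof.
by move=> [g1 g2]; split; [exact: (rintegrable_subr x g1)|exact: (rintegrable_subr x g2)].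
Qed.

Lemma cintegrable_shift (x : R) (g : R -> C) : cintegrable g ->
  cintegrable (fun y => g (y - x)).
Proof.
move=> ig; have := cintegrable_affine (- x) ltr01 ig.
by under eq_fun do rewrite mul1r.
Qed.

Section Convolution.
Variable c : C.
Hypothesis c_neq0 : c != 0.
Hypothesis cP : inversion_constant c.

(** By inversion, [c * phi] is itself a transform, namely of the reflected transform of [phi]. The
    multiplication formula moves that outer transform onto [th] times a character, and the character
    becomes the shift by [y]. *)
Lemma fourierM r s th phi (y : R) : csmooth th -> supp_in r th ->
  csmooth phi -> supp_in s phi ->
  c * fourier (fun t => th t * phi t) (- y) =
  cint (fun x => fourier th (x - y) * fourier phi (- x)).
Proof.
move=> st t0 sp p0.
have it := cintegrable_supp st t0; have ip := cintegrable_supp sp p0.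
have ifp := fourier_integrable sp p0.
have iq : cintegrable (fun x => fourier phi (- x)) by exact: cintegrable_opp.
have E t : c * phi t = fourier (fun x => fourier phi (- x)) t.
  rewrite -(cP sp p0) cint_opp.
    by congr cint; apply/funext => x; rewrite mulrN.
  by apply: cintegrable_meas; have := cintegrable_character (- t) ifp;
    under eq_fun do rewrite mulNr opprK.
have ity : cintegrable (fun t => expi (- (- y * t)) * th t).
  exact: cintegrable_character.
transitivity (cint (fun t => expi (- (- y * t)) * th t * fourier (fun x => fourier phi (- x)) t)).
  rewrite /fourier -cintZ.
    by congr cint; apply/funext => t; rewrite -/(fourier _ t) -E; ring.
  apply: cintegrable_character; apply: (@cintegrable_supp _ s); last exact: supp_in_mull.
  exact: csmoothM.
rewrite (multiplication_formula ity iq); congr cint; apply/funext => x.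
by rewrite fourier_modulate.
Qed.

(** Up to normalization, the norm of the Fourier algebra, whose dual is the space of
    pseudomeasures. *)
Definition Anorm phi : R := rint (@cabs R \o fourier phi).

Lemma Anorm_ge0 phi : 0 <= Anorm phi.
Proof. by apply: rint_ge0 => x; exact: cabs_ge0. Qed.

Lemma AnormD r s phi psi : csmooth phi -> supp_in r phi -> csmooth psi -> supp_in s psi ->
  Anorm (fun x => phi x + psi x) <= Anorm phi + Anorm psi.
Proof.
move=> sp p0 ss s0.
have ip := cintegrable_supp sp p0; have iq := cintegrable_supp ss s0.
have ifp := fourier_integrable sp p0; have ifs := fourier_integrable ss s0.
have i1 := cintegrable_cabs ifp; have i2 := cintegrable_cabs ifs.
rewrite /Anorm -(rintD i1 i2); apply: le_rint.
- have := cintegrable_cabs (cintegrableD ifp ifs); congr rintegrable.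
  by apply/funext => x /=; rewrite fourierD.
- exact: rintegrableD.
- by move=> x /=; rewrite (fourierD _ ip iq) cabsD.
Qed.

Lemma AnormZ (a : C) r phi : csmooth phi -> supp_in r phi ->
  Anorm (fun x => a * phi x) = cabs a * Anorm phi.
Proof.
move=> sp p0; have ip := cintegrable_supp sp p0.
have ifp := fourier_integrable sp p0; have i1 := cintegrable_cabs ifp.
rewrite /Anorm -(rintZ _ i1); congr Rintegral; apply/funext => x.
by rewrite /= (fourierZ _ _ ip) cabsM.
Qed.

(** Modulation translates the transform. All uniformity in the frequency [l] rests on this. *)
Lemma Anorm_modulate (l : R) r phi : csmooth phi -> supp_in r phi ->
  Anorm (fun x => expi (- (l * x)) * phi x) = Anorm phi.
Proof.
move=> sp p0; have ifp := fourier_integrable sp p0.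
rewrite /Anorm -(rint_shift l (rintegrable_meas (cintegrable_cabs ifp))).
by congr Rintegral; apply/funext => x /=; rewrite fourier_modulate.
Qed.

(** A translation multiplies the transform by a unimodular factor; a dilation dilates it and divides
    it by [a], which preserves the L^1 norm. *)
Lemma Anorm_affine (a b : R) r phi : 0 < a -> csmooth phi -> supp_in r phi ->
  Anorm (fun x => phi (a * x + b)) = Anorm phi.
Proof.
move=> a0 sp p0; have ip := cintegrable_supp sp p0.
have ifp := fourier_integrable sp p0; have i1 := cintegrable_cabs ifp.
have av0 : 0 < a^-1 by rewrite invr_gt0.
rewrite /Anorm (rint_affine 0 av0 (rintegrable_meas i1)).
rewrite -(rintZ _ (rintegrable_affine 0 av0 i1)).
congr Rintegral; apply/funext => x.
rewrite /= (fourier_affine _ _ a0 ip) !cabsM cabs_expi mulr1 cabs_real gtr0_norm//.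
by rewrite addr0 (mulrC a^-1 x).
Qed.

(** By [fourierM] the product becomes a convolution, and the L^1 norm of a convolution is bounded
    through Fubini. The 2 comes from [cabs_cint], the inverse of [cabs c] from [fourierM]. *)
Lemma AnormM r s th phi : csmooth th -> supp_in r th -> csmooth phi -> supp_in s phi ->
  Anorm (fun t => th t * phi t) <= 2 * (cabs c)^-1 * (Anorm th * Anorm phi).
Proof.
move=> st t0 sp p0.
have c0 : 0 < cabs c.
  rewrite lt_neqAle cabs_ge0 andbT eq_sym; apply/eqP => /cabs_eq0 /eqP.
  by rewrite (negbTE c_neq0).
have stp : csmooth (fun t => th t * phi t) by exact: csmoothM.
have tp0 : supp_in s (fun t => th t * phi t) by exact: supp_in_mull.
have ift := fourier_integrable st t0; have ifp := fourier_integrable sp p0.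
have it := cintegrable_supp st t0; have ip := cintegrable_supp sp p0.
have iftp := cintegrable_cabs (fourier_integrable stp tp0).
have at_ := cintegrable_cabs ift; have ap := cintegrable_cabs ifp.
have mt := rintegrable_meas at_; have mp := rintegrable_meas ap.
pose F x y := cabs (fourier phi (- x)) * cabs (fourier th (x - y)).
have iFx x : rintegrable (F x) by apply: rintegrableZ; exact: (rintegrable_subr x at_).
have iFy y : rintegrable (F ^~ y).
  have := cintegrable_cabs (cintegrableM (g := fun x => fourier phi (- x))
     (M := 2 * rint (fun x => cabs (phi x))) _ _ (cintegrable_shift y ift)).
  rewrite (_ : _ \o _ = F ^~ y); last by apply/funext => x /=; rewrite cabsM.
  apply; first exact: cmeas_comp (@oppr_measurable R setT) (cintegrable_meas ifp).
  by move=> x; exact: cabs_fourier.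
have FK x : rint (F x) = cabs (fourier phi (- x)) * Anorm th.
  by rewrite /F (rintZ _ (rintegrable_subr x at_)) (rint_subr x mt).
have iK : rintegrable (fun x => cabs (fourier phi (- x)) * Anorm th).
  under eq_fun do rewrite mulrC; apply: rintegrableZ; exact: (rintegrable_opp ap).
have mF : measurable_fun setT (fun z : R * R => F z.1 z.2).
  apply: measurable_funM.
    apply: (measurableT_comp mp); apply: measurable_funN; exact: measurable_fst.
  apply: (measurableT_comp mt); apply: measurable_funB;
    [exact: measurable_fst|exact: measurable_snd].
have FF x y : `|F x y| <= F x y by rewrite ger0_norm// mulr_ge0 ?cabs_ge0.
have FK' x : rint (F x) <= cabs (fourier phi (- x)) * Anorm th by rewrite FK.
have [_ iW W] := rFubini (prod_integrable mF iFx FF iK FK') iFx iFy.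
have -> : Anorm (fun t => th t * phi t) = rint (fun y => cabs (fourier (fun t => th t * phi t) (- y))).
  exact: (rint_opp (rintegrable_meas iftp)).
have -> : Anorm th * Anorm phi = rint (fun y => rint (F ^~ y)).
  rewrite -W; under eq_Rintegral do rewrite FK mulrC.
  by rewrite (rintZ _ (rintegrable_opp ap)) -(rint_opp mp).
rewrite -(rintZ _ iW); apply: le_rint.
- exact: (rintegrable_opp iftp).
- exact: rintegrableZ.
- move=> y; rewrite -(ler_pM2l c0) -cabsM (fourierM _ st t0 sp p0).
  have cK (I : R) : cabs c * (2 * (cabs c)^-1 * I) = 2 * I by field; exact: lt0r_neq0.
  rewrite cK.
  have bnd x : cabs (fourier th (x - y) * fourier phi (- x)) <= F x y.
    by rewrite cabsM mulrC.
  apply: (cabs_cint _ (iFy y) bnd); apply: (cintegrable_le _ (iFy y) bnd).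
  apply: cmeasM; first exact: cintegrable_meas (cintegrable_shift y ift).
  exact: cintegrable_meas (cintegrable_opp ifp).
Qed.

End Convolution.

(** Both sides are the integral of [g x * h y * k (x - y)] over the plane. The sections in [y] are
    integrable because [k] is, those in [x] because [g] is integrable and [k] bounded. *)
Lemma convolution_swap (g h k : R -> C) (Mh Mk : R) :
  cintegrable g -> cmeas h -> (forall x, cabs (h x) <= Mh) ->
  cintegrable k -> (forall x, cabs (k x) <= Mk) ->
  cintegrable (fun x => g x * cint (fun y => h y * k (x - y))) /\
  cint (fun x => g x * cint (fun y => h y * k (x - y))) =
  cint (fun y => h y * cint (fun x => g x * k (x - y))).
Proof.
move=> ig mh hM ik kM.
have mg := cintegrable_meas ig; have mk := cintegrable_meas ik.
have ak := cintegrable_cabs ik; have ag := cintegrable_cabs ig.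
have Mh0 : 0 <= Mh by exact: le_trans (cabs_ge0 _) (hM 0).
have ihk x : cintegrable (fun y => h y * k (x - y)).
  by apply: (cintegrableM mh hM); exact: cintegrable_sub.
have igk y : cintegrable (fun x => g x * k (x - y)).
  under eq_fun do rewrite mulrC.
  apply: (cintegrableM (M := Mk)) => //.
  by have := cmeas_comp (measurable_affine 1 (- y)) mk;
    rewrite (_ : _ \o _ = fun x => k (x - y)) //; apply/funext => x /=; rewrite mul1r.
have [E1 E2] : cintegrable (fun x => cint (fun y => g x * (h y * k (x - y)))) /\
    cint (fun x => cint (fun y => g x * (h y * k (x - y)))) =
    cint (fun y => cint (fun x => g x * (h y * k (x - y)))).
  apply: (@cFubini R _ (fun x y => Mh * cabs (g x) * cabs (k (x - y)))
    (fun x => Mh * cabs (g x) * rint (fun y => cabs (k y)))).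
  - apply: cmeasM; first exact: cmeas_comp measurable_fst mg.
    apply: cmeasM; first exact: cmeas_comp measurable_snd mh.
    apply: (cmeas_comp (k := fun z : R * R => z.1 - z.2)) mk.
    by apply: measurable_funB; [exact: measurable_fst|exact: measurable_snd].
  - by move=> x; apply: rintegrableZ; exact: (rintegrable_subr x ak).
  - move=> x y; rewrite !cabsM mulrA ler_wpM2r ?cabs_ge0// mulrC ler_wpM2r ?cabs_ge0//.
  - under eq_fun do rewrite mulrC; apply: rintegrableZ; exact: rintegrableZ.
  - move=> x; rewrite (rintZ _ (rintegrable_subr x ak)).
    by rewrite (rint_subr x (rintegrable_meas ak)).
  - move=> y; under eq_fun do rewrite mulrCA; exact: cintegrableZ.
have EF : (fun x => cint (fun y => g x * (h y * k (x - y)))) =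
    (fun x => g x * cint (fun y => h y * k (x - y))).
  by apply/funext => x; rewrite cintZ.
rewrite EF in E1 E2; split; first exact: E1.
rewrite E2; congr cint; apply/funext => y.
by rewrite -(cintZ _ (igk y)); congr cint; apply/funext => x; exact: mulrCA.
Qed.

(** Fubini gives measurability only together with integrability, so the convolution is first
    multiplied by the integrable weight [(1 + x ^+ 2)^-1], which is then divided out. *)
Lemma cmeas_convolution (h k : R -> C) (Mh Mk : R) :
  cmeas h -> (forall x, cabs (h x) <= Mh) ->
  cintegrable k -> (forall x, cabs (k x) <= Mk) ->
  cmeas (fun x : R => cint (fun y => h y * k (x - y))).
Proof.
move=> mh hM ik kM; pose g (x : R) : C := ((1 + x ^+ 2)^-1)%:C%C.
have ig : cintegrable g.
  split; first exact: rintegrable_oneDsqrV.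
  rewrite (_ : _ \o _ = fun x => 0 * (1 + x ^+ 2)^-1).
    by apply: rintegrableZ; exact: rintegrable_oneDsqrV.
  by apply/funext => x; rewrite mul0r.
have [i _] := convolution_swap ig mh hM ik kM.
rewrite (_ : (fun x => _) = fun x => (1 + x ^+ 2)%:C%C * (g x * cint (fun y => h y * k (x - y)))).
  apply: cmeasM; last exact: cintegrable_meas i.
  by apply: cmeas_real; apply: measurable_funD => //; exact: measurable_funX.
apply/funext => x; rewrite mulrA -rmorphM/= mulfV ?mul1r//.
by rewrite lt0r_neq0// ltr_pwDl// sqr_ge0.
Qed.

(** [fourier_decay] is applied to [phi] and to its second derivative. In a tail, one factor of the
    bound will be small while the other stays integrable. *)
Lemma fourier_decay2 r phi : csmooth phi -> supp_in r phi ->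
  exists M, forall t, cabs (fourier phi t) <= M * ((1 + t ^+ 2)^-1 * (1 + t ^+ 2)^-1).
Proof.
move=> sp p0.
have ip := cintegrable_supp sp p0.
have sdp := csmooth_cderiv sp; have dp0 := supp_in_cderiv p0.
have sddp := csmooth_cderiv sdp; have ddp0 := supp_in_cderiv dp0.
have iddp := cintegrable_supp sddp ddp0.
have [M1 H1] := fourier_decay sp p0; have [M2 H2] := fourier_decay sddp ddp0.
exists (M1 + M2) => t.
have t0 : 0 < 1 + t ^+ 2 by rewrite ltr_pwDl// sqr_ge0.
rewrite mulrA ler_pdivlMr// -[X in _ * X](ger0_norm (ltW t0)) -cabs_real -cabsM.
have -> : fourier phi t * (1 + t ^+ 2)%:C%C = fourier phi t + (- 1) * fourier (cderiv (cderiv phi)) t.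
  rewrite (fourier_cderiv _ sdp dp0) (fourier_cderiv _ sp p0).
  by apply: complex_ext; rewrite ?(cReM, cImM, cReD, cImD) /cRe /cIm /= ; ring.
by rewrite (le_trans (cabsD _ _))// mulN1r cabsN mulrDl lerD.
Qed.

(** The quantitative use of a pseudomeasure: it is bounded for the norm A. The 2 of [cabs_cint]
    cancels that of [2 * pi]. *)
Lemma cabs_inv_fourier_pair (h : R -> C) (M : R) r phi : cmeas h ->
  (forall x, cabs (h x) <= M) -> csmooth phi -> supp_in r phi ->
  cabs (inv_fourier_pair h phi) <= M / pi * Anorm phi.
Proof.
move=> mh hM sp p0; have ifp := fourier_integrable sp p0.
have ap := cintegrable_cabs ifp.
have iq : cintegrable (fun x => fourier phi (- x)) by exact: cintegrable_opp.
have pi0 : 0 <= (2 * pi)^-1 :> R by rewrite invr_ge0 mulr_ge0// pi_ge0.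
have -> : M / pi * Anorm phi = 2 * rint (fun x => M * (2 * pi)^-1 * cabs (fourier phi (- x))).
  rewrite (rintZ _ (rintegrable_opp ap)) -(rint_opp (rintegrable_meas ap)) /Anorm.
  have E (p : R) : p != 0 -> M / p = 2 * (M * (2 * p)^-1) by move=> ?; field.
  by rewrite mulrA -E// lt0r_neq0// pi_gt0.
apply: cabs_cint.
- apply: (cintegrableM (M := M * (2 * pi)^-1) _ _ iq).
    exact: cmeasM mh (cmeas_cst _ _).
  by move=> x; rewrite cabsM cabs_real ger0_norm ?ler_wpM2r.
- by apply: rintegrableZ; exact: (rintegrable_opp ap).
- by move=> x; rewrite !cabsM ler_wpM2r ?cabs_ge0// cabs_real ger0_norm ?ler_wpM2r.
Qed.

(** The pairing is a convolution of [h] with the transform of [phi], evaluated at [l]. For large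
    [|l|], either [l - y] is large and [h] is small there, or [y] is large and the transform is
    small. *)
Lemma inv_fourier_pair_modulate_cvg (h : R -> C) r phi : Linf h ->
  vanishes_at_infty h -> csmooth phi -> supp_in r phi ->
  vanishes_at_infty (fun l => inv_fourier_pair h (fun x => expi (- (l * x)) * phi x)).
Proof.
move=> [h1 [h2 [Mh hM]]] h0 sp p0.
have mh : cmeas h by [].
have Mh0 : 0 <= Mh by exact: le_trans (cabs_ge0 _) (hM 0).
have ifp := fourier_integrable sp p0; have ap := cintegrable_cabs ifp.
have map_ := rintegrable_meas ap.
have [M HM] := fourier_decay2 sp p0.
have M0 : 0 <= M by have := le_trans (cabs_ge0 _) (HM 0); rewrite expr0n/= addr0 invr1 !mulr1.
have ir := @rintegrable_oneDsqrV R.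
set J := rint (fun x : R => (1 + x ^+ 2)^-1).
have J0 : 0 <= J by apply: rint_ge0 => x; rewrite invr_ge0 addr_ge0// sqr_ge0.
move=> e e0.
(* Each of the two parts will be at most [e / 8]; the 2 of [cabs_cint] then leaves [e / 2]. The
   [+ 1] avoids a zero denominator. *)
pose e1 := e / 8 / (Anorm phi + 1).
have A1 : 0 < Anorm phi + 1 by rewrite ltr_wpDl ?Anorm_ge0.
have e10 : 0 < e1 by rewrite !divr_gt0.
have [A HA] := h0 _ e10.
(* Large enough for the tail to be at most [e / 8], and at least 1, so that [B <= |y|] implies
   [B <= 1 + y ^+ 2]. *)
pose B := Num.max 0 (8 * (Mh * M * J) / e) + 1.
have B1 : 1 <= B by rewrite lerDr le_max lexx.
exists (`|A| + B) => l lAB.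
have eb y : cabs (h (l - y)) * cabs (fourier phi y) <=
    e1 * cabs (fourier phi y) + Mh * M / B * (1 + y ^+ 2)^-1.
  have y0 : 0 < 1 + y ^+ 2 by rewrite ltr_pwDl// sqr_ge0.
  have [yA|yA] := ltP A `|l - y|.
    rewrite -[leLHS]addr0 lerD//.
      by rewrite ler_wpM2r ?cabs_ge0// ltW// HA.
    by rewrite !mulr_ge0// invr_ge0 ?ltW// (lt_le_trans ltr01).
  rewrite -[leLHS]add0r; apply: lerD; first exact: mulr_ge0 (ltW e10) (cabs_ge0 _).
  have yB : B <= `|y|.
    have : `|l| <= `|l - y| + `|y| by rewrite -{1}(subrK y l) ler_normD.
    have : A <= `|A| by exact: ler_norm.
    lra.
  have B0 : 0 < B by rewrite (lt_le_trans ltr01).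
  have y2 : B <= 1 + y ^+ 2.
    rewrite -real_normK ?num_real//.
    rewrite (le_trans yB)// -[leLHS]add0r lerD//.
    by rewrite expr2 ler_peMr// (le_trans B1).
  rewrite -!mulrA ler_pM ?cabs_ge0//; rewrite (le_trans (HM y))//.
  rewrite ler_wpM2l// ler_wpM2r ?invr_ge0 ?(ltW y0)//.
  by rewrite lef_pV2.
have bnd : cabs (inv_fourier_pair h (fun x => expi (- (l * x)) * phi x)) <=
    2 * rint (fun x => (2 * pi)^-1 * (cabs (h x) * cabs (fourier phi (l - x)))).
  have pi0 : 0 <= (2 * pi)^-1 :> R by rewrite invr_ge0 mulr_ge0// pi_ge0.
  have il : cintegrable (fun x => fourier phi (l - x)) by exact: cintegrable_sub.
  have E x : fourier (fun x => expi (- (l * x)) * phi x) (- x) = fourier phi (l - x).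
    by rewrite fourier_modulate addrC.
  rewrite /inv_fourier_pair; under eq_fun do rewrite E.
  apply: cabs_cint.
  - apply: (cintegrableM (M := Mh * (2 * pi)^-1) _ _ il).
      exact: cmeasM mh (cmeas_cst _ _).
    by move=> x; rewrite cabsM cabs_real ger0_norm// ler_wpM2r.
  - apply: rintegrableZ.
    have := cintegrable_cabs (cintegrableM mh hM il).
    by congr rintegrable; apply/funext => x /=; rewrite cabsM.
  - by move=> x; rewrite !cabsM cabs_real ger0_norm// mulrA mulrAC (mulrC (2 * pi)^-1) mulrAC.
apply: (le_lt_trans bnd).
pose G y : R := cabs (h (l - y)) * cabs (fourier phi y).
have i0 : rintegrable G.
  have mh' : cmeas (fun y : R => h (l - y)).
    apply: (cmeas_comp (k := fun y : R => l - y)) mh.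
    by apply: measurable_funB.
  have := cintegrable_cabs (cintegrableM mh' (fun y => hM _) ifp).
  by congr rintegrable; apply/funext => x /=; rewrite cabsM.
have iG := rintegrable_subr l i0.
have EG x : cabs (h x) * cabs (fourier phi (l - x)) = G (l - x).
  by rewrite /G subKr.
have -> : rint (fun x => (2 * pi)^-1 * (cabs (h x) * cabs (fourier phi (l - x)))) =
    (2 * pi)^-1 * rint G.
  under eq_Rintegral do rewrite EG.
  by rewrite (rintZ _ iG) (rint_subr l (rintegrable_meas i0)).
have ub : rint G <=
    e1 * Anorm phi + Mh * M / B * J.
  rewrite /Anorm /J -(rintZ _ ap) -(rintZ _ ir).
  rewrite -(rintD (rintegrableZ _ ap) (rintegrableZ _ ir)).
  by apply: (le_rint i0 _ eb); apply: rintegrableD; exact: rintegrableZ.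
have B0 : 0 < B by rewrite (lt_le_trans ltr01).
have t1 : e1 * Anorm phi <= e / 8.
  rewrite /e1 -mulrA ler_piMr ?divr_ge0 ?(ltW e0)//.
  by rewrite mulrC ler_pdivrMr// mul1r lerDl.
have t2 : Mh * M / B * J <= e / 8.
  rewrite mulrAC ler_pdivrMr//.
  have : 8 * (Mh * M * J) / e <= B.
    by rewrite /B (le_trans (y := Num.max 0 (8 * (Mh * M * J) / e)))// ?le_max ?lexx ?orbT// lerDl.
  rewrite ler_pdivrMr// => ?; lra.
have pi1 : (2 * pi)^-1 <= 1 :> R.
  by rewrite invf_le1 ?mulr_gt0 ?pi_gt0//; have := @pi_ge2 R; lra.
have r0 : 0 <= rint G by apply: rint_ge0 => y; rewrite mulr_ge0 ?cabs_ge0.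
have : (2 * pi)^-1 * rint G <= e / 8 + e / 8.
  by rewrite (le_trans (y := 1 * rint G))// ?ler_wpM2r// mul1r (le_trans ub)// lerD.
lra.
Qed.

End Inversion.

(** * Partitions of unity, null compact sets, Baire category *)

Section SmoothStep.
Variable R : realType.
Local Notation C := R[i].
Let mu := @lebesgue_measure R.
Local Notation rint := (Rintegral mu setT).

Definition bump_function (b : R -> R) := [/\ smooth b, forall x, 0 <= b x, b 0 = 1 &
  exists r : R, forall x : R, r < `|x| -> b x = 0].

(** The real or the imaginary part of [phi] is nonzero at [p]; it is translated to the origin,
    normalized there and squared for positivity. *)
Lemma bump_exists (O : set R) (phi : R -> C) (p : R) :
  test_fun O phi -> phi p != 0 -> exists b, bump_function b.
Proof.
move=> /test_funP [[s1 s2] [r p0]] php.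
have real (g : R -> R) : smooth g -> (forall x, r < `|x| -> g x = 0) -> g p != 0 ->
    exists b, bump_function b.
  move=> sg g0 gp.
  pose k x := (g p)^-1 * g (1 * x + p).
  have sk : smooth k by exact: smoothM (@smooth_cst R (g p)^-1) (smooth_affine (a := 1) (b := p) sg).
  exists (fun x => k x * k x); split.
  - exact: smoothM.
  - by move=> x; rewrite -expr2 sqr_ge0.
  - by rewrite /k mulr0 add0r mulVf// mulr1.
  exists (r + `|p|) => x rx; rewrite /k (g0 (1 * x + p)) ?mulr0//.
  by rewrite mul1r -(ltrD2r `|p|) (lt_le_trans rx)// -{1}(addrK p x) ler_normB.
have [re0|] := eqVneq (cRe (phi p)) 0; last exact: real s1 (supp_inRe p0).
have [im0|] := eqVneq (cIm (phi p)) 0; last exact: real s2 (supp_inIm p0).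
by move: php; rewrite (complex_ext (w := 0) re0 im0) eqxx.
Qed.

Definition smooth_step (s : R -> R) := [/\ smooth s, forall t : R, t <= 0 -> s t = 0 &
  forall t : R, 1 <= t -> s t = 1].

(** The primitive of [b], divided by the total integral, climbs from 0 to 1 on [[- r, r]]; an affine
    change carries this segment to [[0, 1]]. *)
Lemma smooth_step_exists b : bump_function b -> exists s, smooth_step s.
Proof.
move=> [sb b_ge0 b1 [r0 b0']].
pose r := `|r0| + 1.
have r_gt0 : 0 < r by rewrite ltr_wpDl.
have b0 x : r <= `|x| -> b x = 0.
  by move=> rx; apply: b0'; rewrite (lt_le_trans _ rx)// (le_lt_trans (ler_norm r0))// ltrDl.
have cb := smooth_continuous sb.
have ib : rintegrable b by apply: (rintegrable_supp cb b0').
pose F x := Rintegral mu `]-oo, x] b.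
have dF (x : R) : derivable F x 1 /\ derive1 F x = b x.
  apply: (@continuous_FTC1 R b -oo%O x (x + 1)) => //; last exact: cb.
  - by rewrite ltrDl.
  - exact: integrableS ib.
  - exact: ltNyr.
have sF : smooth F.
  apply: smooth_primitive => [x|]; first by case: (dF x).
  by rewrite (_ : derive1 F = b)//; apply/funext => x; case: (dF x).
pose J := rint b.
have J_neq0 : J != 0.
  apply/eqP => J0; have := continuous_rint_eq0 cb ib b_ge0 J0 0.
  by rewrite b1 => /eqP; rewrite oner_eq0.
have F0 (x : R) : x <= - r -> F x = 0.
  move=> xr; transitivity (Rintegral mu `]-oo, x] (fun=> 0)).
    apply: eq_Rintegral => y /set_mem /=; rewrite in_itv/= => yx; apply: b0.
    by rewrite -normrN (le_trans _ (ler_norm _))// lerNr (le_trans yx).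
  by rewrite Rintegral_cst ?mul0r.
have F1 (x : R) : r <= x -> F x = J.
  move=> xr; rewrite /F Rintegral_mkcond; congr Rintegral; apply/funext => y.
  rewrite patchE; case: ifPn => //; rewrite notin_setE/= in_itv/= => /negP.
  by rewrite -ltNge => xy; rewrite b0// (le_trans (le_trans xr (ltW xy)))// ler_norm.
exists (fun t => J^-1 * F (2 * r * t + - r)); split.
- exact: smoothM (@smooth_cst R J^-1) (smooth_affine sF).
- by move=> t t0; rewrite F0 ?mulr0//; nra.
- by move=> t t1; rewrite F1 ?mulVf//; nra.
Qed.

Section Step.
Variable s : R -> R.
Hypothesis sP : smooth_step s.

Let s_smooth : smooth s. Proof. by case: sP. Qed.
Let s0 (t : R) : t <= 0 -> s t = 0. Proof. by case: sP => _ + _; apply. Qed.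
Let s1 (t : R) : 1 <= t -> s t = 1. Proof. by case: sP => _ _; apply. Qed.

(** A difference of consecutive steps, so that sums of integer translates telescope: this is the
    source of the partition of unity. *)
Definition hat (t : R) : C := (s (t + 1) - s t)%:C%C.

Lemma csmooth_hat : csmooth hat.
Proof.
apply: csmooth_real; apply: smoothB; last exact: s_smooth.
have := smooth_affine (a := 1) (b := 1) s_smooth.
by under eq_fun do rewrite mul1r.
Qed.

Lemma supp_hat : supp_in 1 hat.
Proof.
move=> x; rewrite lter_normr => /orP[x1|x1]; rewrite /hat.
  by rewrite !s1 ?subrr//; lra.
by rewrite !s0 ?subrr//; lra.
Qed.

Lemma sum_hat (x : R) (N : nat) : \sum_(j < N) hat (x - j%:R) =
  (s (x + 1) - s (x + 1 - N%:R))%:C%C.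
Proof.
elim: N => [|N IH]; first by rewrite big_ord0 subr0 subrr.
rewrite big_ord_recr/= IH /hat -rmorphD/=; congr (_%:C)%C.
rewrite -natr1 (_ : x - N%:R + 1 = x + 1 - N%:R); last by ring.
by rewrite (_ : x + 1 - (N%:R + 1) = x - N%:R); [ring|ring].
Qed.

(** This is [hat ((t - a) / d - j)], centred at [a + j d] with half-width [d], in the form that the
    affine lemmas match. *)
Definition cell (a d : R) (j : nat) (t : R) : C := hat (d^-1 * t + (- a / d - j%:R)).

Lemma csmooth_cell a d j : csmooth (cell a d j).
Proof. exact: csmooth_affine csmooth_hat. Qed.

Lemma cell_supp (a d : R) j t : 0 < d -> d < `|t - (a + j%:R * d)| -> cell a d j t = 0.
Proof.
move=> d0 H; apply: supp_hat.
have -> : d^-1 * t + (- a / d - j%:R) = (t - (a + j%:R * d)) / d.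
  by field; exact: lt0r_neq0.
by rewrite normrM normfV (gtr0_norm d0) ltr_pdivlMr// mul1r.
Qed.

Lemma cell_supp_in (a d : R) j : 0 < d -> supp_in (`|a + j%:R * d| + d) (cell a d j).
Proof.
move=> d0 x xd; apply: cell_supp => //.
by have := ler_normB (x - (a + j%:R * d)) (- (a + j%:R * d)); rewrite normrN opprK subrK; lra.
Qed.

(** Both end points of the segment are centres, hence [N.+1] cells. Telescoping leaves [s] at an
    argument at least 1 minus [s] at an argument at most 0. *)
Lemma sum_cell (a d : R) (N : nat) t : 0 < d -> a <= t -> t <= a + N%:R * d ->
  \sum_(j < N.+1) cell a d j t = 1.
Proof.
move=> d0 at_ tN.
have E : d^-1 * t + - a / d = (t - a) / d by rewrite mulrBl mulrC mulNr.
under eq_bigr do rewrite /cell addrA E.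
rewrite sum_hat s1; last by rewrite lerDr divr_ge0 ?subr_ge0// ltW.
rewrite s0 ?subr0//.
rewrite -natr1 (_ : (t - a) / d + 1 - (N%:R + 1) = (t - a) / d - N%:R); last by ring.
by rewrite subr_le0 ler_pdivrMr//; lra.
Qed.

Lemma cell_decomposition (a d : R) (N : nat) (phi : R -> C) : 0 < d ->
  (forall t, ~~ (a <= t <= a + N%:R * d) -> phi t = 0) ->
  phi = fun t => \sum_(j < N.+1) cell a d j t * phi t.
Proof.
move=> d0 phi0; apply/funext => t; rewrite -mulr_suml.
have [/andP[h1 h2]|/phi0 ->] := boolP (a <= t <= a + N%:R * d); last by rewrite mulr0.
by rewrite sum_cell// mul1r.
Qed.

(** The arguments of [s] are [2 + (t - x0) / r] and [2 - (t - x0) / r]: both are at least 1 within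
    distance [r] of [x0], and one is at most 0 from distance [2 * r] on. *)
Definition plateau (x0 r t : R) : C :=
  (s (r^-1 * t + (2 - x0 / r)))%:C%C * (s (- r^-1 * t + (2 + x0 / r)))%:C%C.

Lemma csmooth_plateau x0 r : csmooth (plateau x0 r).
Proof. by apply: csmoothM; apply: csmooth_real; exact: smooth_affine. Qed.

Lemma plateau1 (x0 r t : R) : 0 < r -> `|t - x0| <= r -> plateau x0 r t = 1.
Proof.
move=> r0; rewrite ler_norml => /andP[h1 h2]; rewrite /plateau !s1 ?mulr1//.
  rewrite (_ : _ + _ = (- (t - x0)) / r + 2); last by ring.
  suff : -1 <= - (t - x0) / r by lra.
  by rewrite ler_pdivlMr//; lra.
rewrite (_ : _ + _ = (t - x0) / r + 2); last by ring.
suff : -1 <= (t - x0) / r by lra.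
by rewrite ler_pdivlMr//; lra.
Qed.

Lemma plateau0 (x0 r t : R) : 0 < r -> 2 * r <= `|t - x0| -> plateau x0 r t = 0.
Proof.
move=> r0; rewrite ler_normr => /orP[h|h]; rewrite /plateau.
  rewrite (s0 (t := - r^-1 * t + _)) ?mulr0//.
  rewrite (_ : _ + _ = 2 - (t - x0) / r); last by ring.
  suff : 2 <= (t - x0) / r by lra.
  by rewrite ler_pdivlMr//; lra.
rewrite (s0 (t := r^-1 * t + _)) ?mul0r//.
have -> : r^-1 * t + (2 - x0 / r) = 2 - (- (t - x0)) / r.
  by rewrite mulNr opprK mulrBl mulrC addrCA addrA addrAC -addrA.
suff : 2 <= - (t - x0) / r by lra.
by rewrite ler_pdivlMr//; lra.
Qed.

End Step.
End SmoothStep.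

(** * Compactness, null sets and category on the line *)

Section RealLine.
Variable R : realType.
Let mu := @lebesgue_measure R.

(** The cover is given by a predicate, so that its members can carry a property, such as [f] being
    represented there by a pseudofunction. *)
Lemma lebesgue_number (K : set R) (P : set R -> Prop) : compact K ->
  (forall x, K x -> exists2 O, open O & O x /\ P O) ->
  exists2 d : R, 0 < d & forall x, K x -> exists2 O, P O & forall y, `|y - x| < d -> O y.
Proof.
move=> /compact_near_coveringP /(_ R (0 : R)^'+
  (fun d x => exists2 O, P O & forall y, `|y - x| < d -> O y) _) cK KO.
have /cK : forall x, K x -> \forall x' \near x & d \near (0 : R)^'+,
    exists2 O, P O & forall y, `|y - x'| < d -> O y.
  move=> x /KO [V oV [Vx PV]].
  have /nbhs_ballP[e /= e0 He] : nbhs x V by exact: open_nbhs_nbhs.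
  have e2 : 0 < e / 2 by rewrite divr_gt0.
  exists (ball x (e / 2), [set d | d < e / 2]) => /=.
    split; first exact: nbhsx_ballx.
    by near=> d; near: d; exact: nbhs_right_lt.
  move=> [x' d] /= [xx' de]; exists V => // y yd; apply: He.
  rewrite /ball/=; move: xx'; rewrite /ball/= => xx'.
  rewrite -(subrK x' x) -addrA (le_lt_trans (ler_normD _ _))//.
  by move: yd; rewrite distrC => yd; lra.
move=> H; near (0 : R)^'+ => d; exists d; first by near: d; exact: nbhs_right_gt.
by near: d; exact: H.
Unshelve. all: by end_near. Qed.

(** By outer regularity [K] lies in an open set [G] of measure at most [e]. A Lebesgue number puts
    into [G] every short interval near [K], so their total length is at most [e]. *)
Lemma null_compact_cells (K : set R) (e : R) : compact K -> mu.-negligible K -> 0 < e ->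
  exists2 d0 : R, 0 < d0 & forall d, 0 < d -> d < d0 -> forall (a : R) (N : nat)
    (P : {pred 'I_N}), (forall j, j \in P -> exists2 x, K x & `|x - (a + j%:R * d)| <= d) ->
    #|P|%:R * d <= e.
Proof.
move=> cK [B [mB B0 KB]] e0.
have [|G [oG BG GB]] := lebesgue_regularity_outer mB _ e0.
  by rewrite [X in (X < _)%E]B0 ltry.
have [d1 d10 Hd1] := @lebesgue_number K (fun O => O = G) cK
  (fun x Kx => ex_intro2 _ _ G oG (conj (BG _ (KB _ Kx)) erefl)).
(* A point of the interval [c j] below is within [2 * d] of a point of [K]. *)
exists (d1 / 3) => [|d d0 dd a N P HP]; first by rewrite divr_gt0.
have mG : measurable G by exact: open_measurable.
have muG : (mu G <= e%:E)%E.
  rewrite -(setDUK BG) (le_trans (measureU2 _ _ _))//; first exact: measurableD.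
  by rewrite [X in (X + _)%E]B0 add0e ltW.
(* Supports of neighboring cells overlap; these half-open intervals are disjoint, so their measures
   add up. *)
pose c (j : 'I_N) : set R := `[a + j%:R * d, a + j.+1%:R * d[.
have cG j : j \in P -> c j `<=` G.
  move=> /HP [x Kx xd] y; rewrite /c /= in_itv/= -natr1 => /andP[y1 y2].
  have [_ -> ] := Hd1 _ Kx; apply.
  by move: xd; rewrite ler_distlC => /andP[? ?]; rewrite ltr_norml; apply/andP; split; lra.
have mc j : measurable (c j) by exact: measurable_itv.
have muc j : mu (c j) = d%:E.
  rewrite /mu /c lebesgue_measure_itv/= lte_fin -natr1 mulrDl mul1r addrA ltrDl d0.
  by rewrite -EFinB; congr EFin; ring.
have tc : trivIset [set j | j \in P] c.
  apply/trivIsetP => i j _ _ ij; rewrite -subset0 => y [].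
  rewrite /c /= !in_itv/= => /andP[i1 i2] /andP[j1 j2].
  have [ltij|ltji|eqij] := ltngtP i j; last by move/eqP: ij; apply; exact: val_inj.
    have : (i.+1%:R : R) <= j%:R by rewrite ler_nat.
    by rewrite -natr1 in i2 *; nra.
  have : (j.+1%:R : R) <= i%:R by rewrite ler_nat.
  by rewrite -natr1 in j2 *; nra.
have : (mu (\big[setU/set0]_(j < N | P j) c j) <= e%:E)%E.
  apply: le_trans muG; apply: le_measure; rewrite ?inE//.
    by apply: bigsetU_measurable => j _; exact: mc.
  by apply: (big_ind (fun X => X `<=` G)) => [x []|A A' HA HA' x [/HA|/HA']|j /cG].
have -> : mu (\big[setU/set0]_(j < N | P j) c j) = (\sum_(j < N | P j) mu (c j))%E.
  apply: (@measure_bigsetU_ord_cond _ _ _ (@lebesgue_measure R)) => [j _|].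
    exact: mc.
  exact: sub_trivIset tc.
rewrite (eq_bigr (fun=> d%:E)) => [|j _]; last exact: muc.
by rewrite sumEFin lee_fin sumr_const mulr_natl.
Qed.

(** Otherwise one could choose nested closed intervals centred in [S], the one of index [n.+1]
    missing [D n]; their common point lies in [S] but in no [D n]. *)
Lemma baire_relatively_closed (U F : set R) (D : nat -> set R) (S := U `&` F) :
  open U -> closed F -> S !=set0 -> (forall x, S x -> exists n, D n x) ->
  exists n (x0 r : R), [/\ S x0, 0 < r & forall x, S x -> `|x - x0| < r ->
    forall e, 0 < e -> exists2 t, D n t & `|t - x| < e].
Proof.
move=> oU cF [x1 Sx1] SD; apply: contrapT => H.
have step n (x0 : R) r : S x0 -> 0 < r -> exists p : R * R,
    [/\ S p.1, 0 < p.2, p.2 <= r / 2, `|p.1 - x0| < r / 2 &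
      forall t, D n t -> p.2 < `|t - p.1|].
  move=> Sx0 r0; apply: contrapT => H'; apply: H; exists n, x0, (r / 2); split => //.
    by rewrite divr_gt0.
  move=> x Sx xx0 e e0; apply: contrapT => He; apply: H'.
  exists (x, Num.min (r / 2) (e / 2)); split => //=.
  - by rewrite lt_min !divr_gt0.
  - by rewrite ge_min lexx.
  move=> t Dt; rewrite ltNge; apply/negP => tx; apply: He; exists t => //.
  by rewrite (le_lt_trans tx)// gt_min; apply/orP; right; lra.
(* Starting with radius [r1 / 2] keeps the limit point inside [U]; closedness of [F] handles the
   other condition. *)
have /nbhs_ballP[r1 /= r10 Hr1] : nbhs x1 U by apply: open_nbhs_nbhs; split => //; case: Sx1.
pose T := {p : R * R | S p.1 /\ 0 < p.2}.
have next n (p : T) : {q : T | (sval q).2 <= (sval p).2 / 2 /\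
    `|(sval q).1 - (sval p).1| < (sval p).2 / 2 /\
    forall t, D n t -> (sval q).2 < `|t - (sval q).1|}.
  case: p => -[x0 r] /= [Sx0 r0]; apply: cid.
  by have [p [p1 p2 p3 p4 p5]] := step n x0 r Sx0 r0; exists (exist _ p (conj p1 p2)).
have r2 : 0 < r1 / 2 by rewrite divr_gt0.
pose p0 : T := exist _ (x1, r1 / 2) (conj Sx1 r2).
pose q := fix q n : T := if n is m.+1 then sval (next m (q m)) else p0.
pose x n := (sval (q n)).1; pose r n := (sval (q n)).2.
have Sx n : S (x n) by rewrite /x; case: (q n) => -[? ?] [].
have rgt0 n : 0 < r n by rewrite /r; case: (q n) => -[? ?] [].
have rS n : r n.+1 <= r n / 2 by have [] := svalP (next n (q n)).
have xS n : `|x n.+1 - x n| < r n / 2 by have [_ []] := svalP (next n (q n)).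
have xD n t : D n t -> r n.+1 < `|t - x n.+1|.
  by have [_ [_]] := svalP (next n (q n)); apply.
have nest n m : x n - r n <= x (n + m)%N - r (n + m)%N /\
    x (n + m)%N + r (n + m)%N <= x n + r n.
  elim: m => [|m [IH1 IH2]]; first by rewrite addn0.
  rewrite addnS; have := rS (n + m)%N; have := xS (n + m)%N; rewrite ltr_distl.
  by move=> /andP[h1 h2] h3; split; lra.
have cross n m : x n - r n <= x m + r m.
  have [nm|/ltnW mn] := leqP n m.
    have [h _] := nest n (m - n)%N; rewrite subnKC// in h; have := rgt0 m; lra.
  have [_ h] := nest m (n - m)%N; rewrite subnKC// in h; have := rgt0 n; lra.
pose A := range (fun n => x n - r n).
have Aub m : ubound A (x m + r m) by move=> _ [n _ <-].
have hA : has_sup A by split; [exists (x 0%N - r 0%N), 0%N|exists (x 0%N + r 0%N)].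
pose z := sup A.
have zr n : `|z - x n| <= r n.
  rewrite ler_distl; apply/andP; split.
    by apply: sup_upper_bound => //; exists n.
  by apply: sup_le_ub; [case: hA|exact: Aub].
(* The radii at least halve; this weaker bound is enough for them to tend to 0. *)
have rn n : r n <= r 0%N / n.+1%:R.
  elim: n => [|n IH]; first by rewrite divr1.
  apply: (le_trans (rS n)); rewrite ler_pdivlMr//; rewrite ler_pdivlMr// in IH.
  have n0 : 0 <= n%:R :> R by [].
  have E1 : n.+1%:R = n%:R + 1 :> R by rewrite natr1.
  have E2 : n.+2%:R = n%:R + 2 :> R by rewrite -!natr1; ring.
  rewrite E1 in IH; rewrite E2.
  by have := rgt0 n; nra.
have Uz : U z.
  apply: Hr1; rewrite /ball/= distrC (le_lt_trans (zr 0%N))// /r/= ltr_pdivrMr//; lra.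
have Fz : F z.
  apply: contrapT => nFz.
  have /nbhs_ballP[e /= e0 He] : nbhs z (~` F).
    by apply: open_nbhs_nbhs; split => //; exact: closed_openC.
  have [n] : exists n, r 0%N / n.+1%:R < e.
    have : 0 < e / r 0%N by rewrite divr_gt0.
    move=> /ltr_add_invr [n]; rewrite add0r => Hn; exists n.
    by rewrite mulrC -ltr_pdivlMr.
  move=> ne; have [_ Fx] := Sx n; apply: (He (x n)) Fx.
  by rewrite /ball/= (le_lt_trans (zr n))// (le_lt_trans (rn n)).
have [n Dz] := SD z (conj Uz Fz).
by have := xD n z Dz; rewrite ltNge zr.
Qed.

End RealLine.

(** * Decay of modulated test functions *)

Section Distributions.
Variable R : realType.
Local Notation C := R[i].
Let mu := @lebesgue_measure R.
Implicit Types (phi psi th : R -> C) (U W K : set R).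

Definition modulate (l : R) phi (x : R) : C := expi (- (l * x)) * phi x.

Lemma csmooth_character (l : R) : csmooth (fun x : R => expi (- (l * x))).
Proof. by have := @csmooth_expi R (- l); under eq_fun do rewrite mulNr. Qed.

Lemma test_fun_modulate U (l : R) phi : test_fun U phi -> test_fun U (modulate l phi).
Proof. exact: test_funM (csmooth_character l). Qed.

Lemma test_fun0 U : test_fun U (fun=> 0).
Proof.
have [s1 s2] := @csmooth_cst R 0.
by do 2 split => //; exists set0; split => //; exact: compact0.
Qed.

Lemma test_fun_restrict W (c r : R) phi : csmooth phi ->
  (forall x, r < `|x - c| -> phi x = 0) -> (forall x, `|x - c| <= r -> W x) ->
  test_fun W phi.
Proof.
move=> [s1 s2] p0 cW; split; first exact: s1.
split; first exact: s2.
exists `[c - r, c + r]; split.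
- exact: segment_compact.
- by move=> x; rewrite /= in_itv/= -ler_distl; exact: cW.
- by move=> x /negP; rewrite /= in_itv/= -ler_distl -ltNge; exact: p0.
Qed.

Section Functional.
Variables (U : set R) (f : (R -> C) -> C).
Hypothesis fP : is_distribution U f.

Lemma distr0 : f (fun=> 0) = 0.
Proof.
have [lin _] := fP; have := lin _ _ 1 (@test_fun0 U) (@test_fun0 U).
under eq_fun do rewrite mul1r addr0.
by rewrite mul1r => /eqP; rewrite -subr_eq0 opprD addNKr oppr_eq0 => /eqP.
Qed.

(** [f] is linear on test functions only, so the induction must also carry that partial sums are
    test functions. *)
Lemma distr_sum n (g : nat -> R -> C) : (forall j, (j < n)%N -> test_fun U (g j)) ->
  test_fun U (fun x => \sum_(j < n) g j x) /\
  f (fun x => \sum_(j < n) g j x) = \sum_(j < n) f (g j).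
Proof.
elim: n => [|n IH] tg.
  rewrite (_ : (fun x => _) = fun=> 0); first by rewrite big_ord0 distr0; split => //; exact: test_fun0.
  by apply/funext => x; rewrite big_ord0.
have [|tn fn] := IH; first by move=> j jn; apply: tg; rewrite ltnS ltnW.
have tgn := tg n (ltnSn n).
have E : (fun x => \sum_(j < n.+1) g j x) = fun x => \sum_(j < n) g j x + 1 * g n x.
  by apply/funext => x; rewrite big_ord_recr mul1r.
rewrite E big_ord_recr/= -fn; split; last by rewrite fP.1// mul1r.
have [s1 _] := test_funP tn; have [s2 _] := test_funP tgn.
have [u1 [u2 [K [cK KU K0]]]] := tn; have [v1 [v2 [L [cL LU L0]]]] := tgn.
have [w1 w2] : csmooth (fun x => \sum_(j < n) g j x + 1 * g n x).
  exact: csmoothD s1 (csmoothM (csmooth_cst 1) s2).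
split; first exact: w1.
split; first exact: w2.
exists (K `|` L); split.
- exact: compactU.
- by move=> x [/KU|/LU].
- by move=> x /not_orP [Kx Lx]; rewrite K0// L0// mulr0 addr0.
Qed.

(** As a function of [l], the value [f (modulate l phi)] is formally the Fourier transform of [phi]
    times [f]. *)
Definition decays phi := vanishes_at_infty (fun l => f (modulate l phi)).

Lemma decays0 : decays (fun=> 0).
Proof.
move=> e e0; exists 0 => l _; rewrite (_ : modulate _ _ = fun=> 0) ?distr0 ?cabs0//.
by apply/funext => x; rewrite /modulate mulr0.
Qed.

Lemma vanishes_sum n (P : pred 'I_n) (g : 'I_n -> R -> C) :
  (forall j, P j -> vanishes_at_infty (g j)) ->
  vanishes_at_infty (fun l => \sum_(j < n | P j) g j l).
Proof.
move=> gP; rewrite (_ : (fun l => _) = \big[(fun u v : R -> C => fun l => u l + v l)/(fun=> 0)]_(j < n | P j) g j); last first.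
  apply/funext => l; elim/big_ind2 : _ => // [u u' v v' <- <-//].
elim/big_ind : _ => //.
- by move=> e e0; exists 0 => l _; rewrite cabs0.
- move=> u v hu hv e e0; have e2 : 0 < e / 2 by rewrite divr_gt0.
  have [A HA] := hu _ e2; have [B HB] := hv _ e2.
  exists (Num.max A B) => l; rewrite gt_max => /andP[Al Bl].
  rewrite (le_lt_trans (cabsD _ _))//.
  by have := HA _ Al; have := HB _ Bl; lra.
Qed.

Variable s : R -> R.
Hypothesis sP : smooth_step s.

Lemma modulate_sum l n (g : nat -> R -> C) :
  modulate l (fun t => \sum_(j < n) g j t) = fun t => \sum_(j < n) modulate l (g j) t.
Proof. by apply/funext => t; rewrite /modulate mulr_sumr. Qed.

(** The local representations of [f] differ from place to place, so [phi] is cut into cells each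
    contained in one neighborhood where [f] is a pseudofunction. *)
Lemma decays_local_pseudofunction W phi : W `<=` U -> local_pseudofunction W f ->
  test_fun W phi -> decays phi.
Proof.
move=> WU fW tp; have [sp [r0 p0]] := test_funP tp.
have [_ [_ [K [cK KW K0]]]] := tp.
have [x Kx|d d0 Hd] := @lebesgue_number R K (fun V => coincides_with_pseudofunction V f) cK.
  by have [V [oV Vx _ cV]] := fW x (KW x Kx); exists V.
pose r := `|r0| + 1; have r_gt0 : 0 < r by rewrite ltr_wpDl.
(* A cell meeting [K] at [x] lies within [2 * d'], hence within [d], of [x]. A cell missing [K]
   contributes zero. *)
pose d' := d / 3; have d'0 : 0 < d' by rewrite divr_gt0.
have [N HN] : exists N : nat, 2 * r / d' <= N%:R.
  by exists (Num.truncn (2 * r / d')).+1; rewrite ltW// truncnS_gt.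
pose phij (j : nat) (t : R) := cell s (- r) d' j t * phi t.
have pE : phi = fun t => \sum_(j < N.+1) phij j t.
  apply: cell_decomposition => // t; rewrite negb_and -!ltNge => H; apply: p0.
  have h1 := ler_norm r0; rewrite ler_pdivrMr// in HN; rewrite ltr_normr.
  by case/orP: H => H; apply/orP; [right|left]; rewrite /r in H HN *; lra.
have tj j : test_fun W (phij j) by exact: test_funM (csmooth_cell sP _ _ _) tp.
have fE l : f (modulate l phi) = \sum_(j < N.+1) f (modulate l (phij j)).
  rewrite {1}pE modulate_sum (distr_sum (g := fun j => modulate l (phij j)) _).2//.
  by move=> j _; exact: test_fun_modulate (test_funS WU (tj j)).
rewrite /decays (_ : (fun l => _) = fun l => \sum_(j < N.+1) f (modulate l (phij j))); last first.
  by apply/funext.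
apply: (vanishes_sum (g := fun j l => f (modulate l (phij j)))) => j _.
have [[x [Kx xj]]|H] := pselect (exists x, K x /\ `|x - (- r + j%:R * d')| <= d').
  have [V [h [hL [h0 hV]]] HV] := Hd x Kx.
  have tV : test_fun V (phij j).
    apply: (@test_fun_restrict V (- r + j%:R * d') d').
    - exact: csmoothM (csmooth_cell sP _ _ _) sp.
    - by move=> t tj'; rewrite /phij (cell_supp sP d'0 tj') mul0r.
    - move=> y yj; apply: HV; move: xj yj; rewrite !ler_norml ltr_norml /d'.
      by move=> /andP[? ?] /andP[? ?]; apply/andP; split; lra.
  rewrite (_ : (fun l => _) = fun l => inv_fourier_pair h (modulate l (phij j))); last first.
    by apply/funext => l; rewrite hV//; exact: test_fun_modulate.
  have [sj [rj pj]] := test_funP tV.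
  exact: inv_fourier_pair_modulate_cvg hL h0 sj pj.
rewrite (_ : phij j = fun=> 0); first exact: decays0.
apply/funext => t; rewrite /phij; have [Kt|nKt] := pselect (K t); last by rewrite K0 ?mulr0.
rewrite (cell_supp sP d'0) ?mul0r// ltNge; apply/negP => tj'; apply: H; by exists t.
Qed.

Lemma le_cabs_sum n (P : pred 'I_n) (g : 'I_n -> C) (B : R) :
  (forall j, P j -> cabs (g j) <= B) ->
  cabs (\sum_(j < n | P j) g j) <= #|P|%:R * B.
Proof.
move=> gB; apply: (@le_trans _ _ (\sum_(j < n | P j) B)); last first.
  by rewrite sumr_const mulr_natl.
apply: (big_ind2 (fun (u : C) (v : R) => cabs u <= v)) => //.
- by rewrite cabs0.
- by move=> u u' v v' hu hv; rewrite (le_trans (cabsD _ _))// lerD.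
Qed.

Variable c : C.
Hypothesis c_neq0 : c != 0.
Hypothesis cP : inversion_constant c.

(* Rescaling the cell to unit size costs nothing in the [Anorm], so the factor
   [x - t] contributes a factor [d]. *)
Lemma Anorm_cell (a d t : R) (j : nat) : 0 < d -> `|t - (a + j%:R * d)| <= 2 * d ->
  Anorm (fun x => (x - t)%:C%C * cell s a d j x) <=
  d * (Anorm (fun u => u%:C%C * hat s u) + 2 * Anorm (hat s)).
Proof.
move=> d0 tj; have dn0 := lt0r_neq0 d0.
(* Offset of the centre in units of [d]: in the rescaled variable [u], [x - t] equals
   [d * (u + beta)]. *)
pose beta := (a + j%:R * d - t) / d.
have hb : `|beta| <= 2.
  by rewrite /beta normrM normfV (gtr0_norm d0) ler_pdivrMr// distrC.
have sh := csmooth_hat sP; have h0 := supp_hat sP.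
pose g1 (u : R) : C := u%:C%C * hat s u.
have s1 : csmooth g1 by exact: csmoothM (csmooth_real (@smooth_id R)) sh.
have p1 : supp_in 1 g1 by exact: supp_in_mull h0.
pose g2 (u : R) : C := beta%:C%C * hat s u.
have s2 : csmooth g2 by exact: csmoothM (csmooth_cst _) sh.
have p2 : supp_in 1 g2 by exact: supp_in_mull h0.
have s12 : csmooth (fun u => g1 u + g2 u) by exact: csmoothD s1 s2.
have p12 : supp_in 1 (fun u => g1 u + g2 u).
  by move=> x x1; rewrite p1// p2// addr0.
pose g u := d%:C%C * (g1 u + g2 u).
have sg : csmooth g by exact: csmoothM (csmooth_cst _) s12.
have pg : supp_in 1 g by exact: supp_in_mull p12.
have dv0 : 0 < d^-1 by rewrite invr_gt0.
have -> : (fun x => (x - t)%:C%C * cell s a d j x) =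
    (fun x => g (d^-1 * x + (- a / d - j%:R))).
  apply/funext => x; pose u := d^-1 * x + (- a / d - j%:R).
  have -> : (x - t)%:C%C = d%:C%C * (u%:C%C + beta%:C%C) :> C.
    by rewrite -rmorphD -rmorphM/=; congr (_%:C)%C; rewrite /u /beta; field.
  by rewrite /g /g1 /g2 /cell -/u; ring.
rewrite (Anorm_affine _ dv0 sg pg) (AnormZ _ s12 p12) cabs_real (gtr0_norm d0).
rewrite ler_wpM2l ?(ltW d0)// (le_trans (AnormD s1 p1 s2 p2))// lerD2l.
by rewrite (AnormZ _ sh h0) cabs_real ler_wpM2r ?Anorm_ge0.
Qed.

(** [D] collects points at which the estimate holds with the common [kappa] and [M]. Each cell
    meeting the complement of [W] then contributes at most [d * Q], with [Q] independent of [d] and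
    of the frequency. *)
Lemma decays_null (W D : set R) (a b kappa M : R) phi :
  W `<=` U -> open W -> local_pseudofunction W f ->
  mu.-negligible (`[a, b] `&` ~` W) ->
  0 < kappa -> 0 <= M ->
  (forall x, a <= x <= b -> ~ W x -> forall e, 0 < e -> exists2 t, D t & `|t - x| < e) ->
  (forall t psi, D t -> test_fun U psi -> (forall x, kappa <= `|x - t| -> psi x = 0) ->
     cabs (f psi) <= M * Anorm (fun x => (x - t)%:C%C * psi x)) ->
  test_fun U phi -> (forall x, ~~ (a <= x <= b) -> phi x = 0) -> decays phi.
Proof.
move=> WU oW fW K0 kappa0 M0 dense DM tp phi0 e e0.
have [sp [r p0]] := test_funP tp.
have cK : compact (`[a, b] `&` ~` W).
  by apply: compact_closedI; [exact: segment_compact|exact: open_closedC].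
have C0 : 0 <= 2 * (cabs c)^-1 :> R by rewrite mulr_ge0// invr_ge0 cabs_ge0.
pose H := Anorm (fun u => u%:C%C * hat s u) + 2 * Anorm (hat s).
have H0 : 0 <= H by rewrite addr_ge0 ?mulr_ge0 ?Anorm_ge0.
pose Q := M * (2 * (cabs c)^-1 * (H * Anorm phi)).
have Q0 : 0 <= Q by rewrite !mulr_ge0 ?Anorm_ge0 ?invr_ge0 ?cabs_ge0.
have Q1 : 0 < Q + 1 by rewrite ltr_wpDl.
have e'0 : 0 < e / 2 / (Q + 1) by rewrite !divr_gt0.
have [d0 d00 Hd0] := null_compact_cells cK K0 e'0.
(* The first bound serves the cell count. The second puts the cell inside the [kappa]-neighborhood
   of a point [t] within [2 * d] of its centre. *)
pose d := Num.min (d0 / 2) (kappa / 4).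
have dgt0 : 0 < d by rewrite lt_min !divr_gt0.
have dd0 : d < d0 by rewrite /d gt_min; apply/orP; left; lra.
have dk : d <= kappa / 4 by rewrite /d ge_min lexx orbT.
have [N HN] : exists N : nat, (b - a) / d <= N%:R.
  by exists (Num.truncn ((b - a) / d)).+1; rewrite ltW// truncnS_gt.
rewrite ler_pdivrMr// in HN.
pose phij (j : nat) (t : R) := cell s a d j t * phi t.
have pE : phi = fun t => \sum_(j < N.+1) phij j t.
  apply: cell_decomposition => // t; rewrite negb_and -!ltNge => Ht; apply: phi0.
  by rewrite negb_and -!ltNge; case/orP: Ht => Ht; apply/orP; [left|right; lra].
have tj j : test_fun U (phij j) by exact: test_funM (csmooth_cell sP _ _ _) tp.
have fE l : f (modulate l phi) = \sum_(j < N.+1) f (modulate l (phij j)).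
  rewrite {1}pE modulate_sum (distr_sum (g := fun j => modulate l (phij j)) _).2//.
  by move=> j _; exact: test_fun_modulate (tj j).
pose P : pred 'I_N.+1 := fun j => `[< exists2 x, (`[a, b] `&` ~` W) x &
   `|x - (a + j%:R * d)| <= d >].
have HP : forall j, j \in P -> exists2 x, (`[a, b] `&` ~` W) x & `|x - (a + j%:R * d)| <= d.
  by move=> j /asboolP.
have cardP := Hd0 d dgt0 dd0 a N.+1 P HP.
(* Such a piece has its support in [W], so it is a test function there. *)
have good : vanishes_at_infty (fun l => \sum_(j < N.+1 | ~~ P j) f (modulate l (phij j))).
  apply: (vanishes_sum (g := fun j l => f (modulate l (phij j)))) => j nPj.
  apply: (decays_local_pseudofunction WU fW).
  have [u1 u2] : csmooth (phij j) by exact: csmoothM (csmooth_cell sP _ _ _) sp.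
  split; first exact: u1.
  split; first exact: u2.
  exists (`[a, b] `&` `[a + j%:R * d - d, a + j%:R * d + d]); split.
  - by apply: compact_closedI; [exact: segment_compact|exact: interval_closed].
  - move=> x [xab]; rewrite /= in_itv/= -ler_distl => xj; apply: contrapT => nWx.
    by move/asboolP: nPj; apply; exists x.
  - move=> x /not_andP [xab|xj]; rewrite /phij.
      rewrite phi0 ?mulr0//; apply/negP => h; apply: xab; rewrite /= in_itv/=; exact: h.
    rewrite (cell_supp sP dgt0) ?mul0r// ltNge; apply/negP; rewrite ler_distl => h.
    by apply: xj; rewrite /= in_itv.
(* [D] is only dense near [x], so [t] is chosen within [d] of [x], hence within [2 * d] of the
   centre. *)
have bad l j : P j -> cabs (f (modulate l (phij j))) <= d * Q.
  move=> /asboolP [x [xab nWx] xj].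
  rewrite /= in_itv/= in xab.
  have [t Dt tx] := dense x xab nWx d dgt0.
  have tj2 : `|t - (a + j%:R * d)| <= 2 * d.
    have := ler_distD x t (a + j%:R * d); lra.
  apply: le_trans (DM t _ Dt (test_fun_modulate l (tj j)) _) _.
    move=> y ky; rewrite /modulate /phij (cell_supp sP dgt0) ?mul0r ?mulr0//.
    have := ler_distD (a + j%:R * d) y t; rewrite (distrC (a + j%:R * d) t); lra.
  pose th x : C := (x - t)%:C%C * cell s a d j x.
  have sth : csmooth th.
    apply: csmoothM; last exact: (csmooth_cell sP).
    by apply: csmooth_real; apply: smoothB; [exact: smooth_id|exact: smooth_cst].
  have pth : supp_in (`|a + j%:R * d| + d) th.
    by apply: supp_in_mull; exact: (cell_supp_in sP).
  have -> : (fun x => (x - t)%:C%C * modulate l (phij j) x) =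
      (fun x => expi (- (l * x)) * (th x * phi x)).
    by apply/funext => y; rewrite /modulate /phij /th; ring.
  rewrite (Anorm_modulate l (csmoothM sth sp) (supp_in_mull _ p0)).
  have hA : Anorm th <= d * H by exact: Anorm_cell.
  have hM := AnormM c_neq0 cP sth pth sp p0.
  have ph0 := Anorm_ge0 phi.
  rewrite /Q mulrCA; apply: (ler_wpM2l M0); apply: (le_trans hM).
  move: (Anorm th) (Anorm phi) hA ph0 => u v hu hv.
  rewrite [leRHS]mulrCA; apply: (ler_wpM2l C0); rewrite [leRHS]mulrA; exact: ler_wpM2r hv _ _ hu.
have [A HA] := good _ (divr_gt0 e0 (ltr0n R 2)).
exists A => l Al; rewrite fE (bigID P)/= (le_lt_trans (cabsD _ _))//.
have h1 := HA l Al.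
have h2 := le_cabs_sum (fun j => @bad l j).
have h3 : #|P|%:R * (d * Q) <= e / 2.
  rewrite mulrA (le_trans (ler_wpM2r Q0 cardP))// mulrAC ler_pdivrMr//.
  by rewrite ler_wpM2l ?divr_ge0 ?(ltW e0)// lerDl.
lra.
Qed.

End Functional.
End Distributions.

(** * From decay to a pseudofunction, and the theorem *)

Section Main.
Variable R : realType.
Local Notation C := R[i].
Let mu := @lebesgue_measure R.

(* Supplies the case in which there is no nonzero test function, so that no explicit
   bump function has to be constructed. *)
Lemma trivial_local_pseudofunction (U : set R) (f : (R -> C) -> C) :
  open U -> is_distribution U f -> (forall phi, test_fun U phi -> phi = fun=> 0) ->
  local_pseudofunction U f.
Proof.
move=> oU fP triv x Ux; exists U; split => //; exists (fun=> 0); split; last split.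
- split; first exact: measurable_cst.
  by split; [exact: measurable_cst|exists 0 => y; rewrite cabs0].
- by move=> e e0; exists 0 => y _; rewrite cabs0.
- move=> phi /triv ->; rewrite (distr0 fP) /inv_fourier_pair.
  by under eq_fun do rewrite !mul0r; rewrite cint0.
Qed.

Section Representation.
Variables (c : C) (f : (R -> C) -> C) (s : R -> R).
Hypotheses (c_neq0 : c != 0) (cP : inversion_constant c) (sP : smooth_step s).

(* On the ball [f] is represented by [x |-> (2 pi / c) f (phi e_x)], where [phi] is a
   cutoff equal to [1] there and [e_x t = expi (- x t)]. *)
Lemma pseudofunction_of_decay (V : set R) (h0 : R -> C) (x0 r : R) : 0 < r ->
  (forall x, `|x - x0| <= 2 * r -> V x) -> Linf h0 ->
  (forall phi, test_fun V phi ->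
     f phi = inv_fourier_pair h0 (fun t => (t - x0)%:C%C * phi t)) ->
  decays f (plateau s x0 r) ->
  coincides_with_pseudofunction (ball x0 r) f.
Proof.
move=> r0 V2 [h1 [h2 [M hM]]] fh dec; have mh0 : cmeas h0 by [].
pose phi := plateau s x0 r.
have sp : csmooth phi by exact: csmooth_plateau.
have tp : test_fun V phi.
  apply: (@test_fun_restrict R V x0 (2 * r)) => // x x2.
  by rewrite /phi (plateau0 sP r0)// ltW.
have [_ [rp p0]] := test_funP tp.
pose th (t : R) : C := (t - x0)%:C%C * phi t.
have st : csmooth (fun t : R => (t - x0)%:C%C : C).
  by apply: csmooth_real; apply: smoothB; [exact: smooth_id|exact: smooth_cst].
have sth : csmooth th by exact: csmoothM st sp.
have pth : supp_in rp th by exact: supp_in_mull p0.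
have ith := fourier_integrable sth pth; have it := cintegrable_supp sth pth.
pose h0' y : C := h0 y * ((2 * pi)^-1)%:C%C.
have pi0 : 0 <= (2 * pi)^-1 :> R by rewrite invr_ge0 mulr_ge0// pi_ge0.
have mh0' : cmeas h0' by exact: cmeasM mh0 (cmeas_cst _ _).
have hM' y : cabs (h0' y) <= M * (2 * pi)^-1.
  by rewrite /h0' cabsM cabs_real ger0_norm// ler_wpM2r.
have kM y := cabs_fourier y it.
(* Convolution form, which gives measurability now and the exchange of integrals below. *)
have F x : f (modulate x phi) = cint (fun y => h0' y * fourier th (x - y)).
  rewrite (fh _ (test_fun_modulate x tp)) /inv_fourier_pair; congr cint.
  apply/funext => y; congr (_ * _).
  rewrite (_ : (fun t => _) = fun t => expi (- (x * t)) * th t).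
    by rewrite fourier_modulate addrC.
  by apply/funext => t; rewrite /modulate /th; ring.
(* Cancels the [(2 * pi)^-1] of [inv_fourier_pair] and the [c] of [fourierM]. *)
pose k : C := (2 * pi)%:C%C / c.
exists (fun x => k * f (modulate x phi)); split; last split.
- have [m1 m2] : cmeas (fun x => k * f (modulate x phi)).
    apply: cmeasM; first exact: cmeas_cst.
    rewrite (_ : (fun x => f _) = fun x => cint (fun y => h0' y * fourier th (x - y))).
      exact: cmeas_convolution mh0' hM' ith kM.
    by apply/funext.
  split => //; split => //; exists (cabs k * (M / pi * Anorm th)) => x.
  rewrite cabsM ler_wpM2l ?cabs_ge0// (fh _ (test_fun_modulate x tp)).
  rewrite (_ : (fun t => _) = fun t => expi (- (x * t)) * th t); last first.
    by apply/funext => t; rewrite /modulate /th; ring.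
  rewrite -(Anorm_modulate x sth pth).
  apply: (cabs_inv_fourier_pair mh0 hM) (supp_in_mull _ pth).
  exact: csmoothM (csmooth_character x) sth.
- move=> e e0; have k1 : 0 < cabs k + 1 by rewrite ltr_wpDl ?cabs_ge0.
  have [A HA] := dec _ (divr_gt0 e0 k1); exists A => x Ax.
  rewrite cabsM; have := HA x Ax; rewrite ltr_pdivlMr// -/phi => h.
  apply: le_lt_trans h; rewrite mulrC ler_wpM2l ?cabs_ge0// lerDl//.
- move=> psi tpsi; have [spsi [rs ps0]] := test_funP tpsi.
  have ballV : ball x0 r `<=` V.
    by move=> x; rewrite /ball/= distrC => xr; apply: V2; lra.
  have ifs := fourier_integrable spsi ps0.
  (* The plateau equals 1 on the ball that carries [psi], so it can be inserted freely. *)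
  have psiE : (fun t => (t - x0)%:C%C * psi t) = fun t => th t * psi t.
    apply/funext => t; rewrite /th /phi.
    have [tr|tr] := leP `|t - x0| r; first by rewrite (plateau1 sP r0 tr) mulr1.
    have [_ [_ [K [_ KV ->]]]] := tpsi; first by rewrite !mulr0.
    by move=> /KV; rewrite /ball/= distrC ltNge (ltW tr).
  rewrite (fh _ (test_funS ballV tpsi)) psiE /inv_fourier_pair.
  have [_ swap] := convolution_swap (cintegrable_opp ifs) mh0' hM' ith kM.
  have E1 : c * cint (fun y => h0 y * ((2 * pi)^-1)%:C%C * fourier (fun t => th t * psi t) (- y)) =
      cint (fun x => fourier psi (- x) * f (modulate x phi)).
    under [in RHS]eq_fun => x do rewrite F.
    rewrite swap -cintZ; last first.
      apply: (cintegrableM mh0' hM'); apply: cintegrable_opp.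
      by apply: (@fourier_integrable R rs); [exact: csmoothM sth spsi|exact: supp_in_mull].
    congr cint; apply/funext => y; rewrite mulrCA (fourierM cP y sth pth spsi ps0).
    by congr (_ * cint _); apply/funext => x; exact: mulrC.
  pose G x : C := fourier psi (- x) * f (modulate x phi).
  have iG : cintegrable G.
    have [i1 _] := convolution_swap (cintegrable_opp ifs) mh0' hM' ith kM.
    by move: i1; congr cintegrable; apply/funext => x; rewrite /G F.
  have EG : (fun x => k * f (modulate x phi) * ((2 * pi)^-1)%:C%C * fourier psi (- x)) =
      (fun x => k * ((2 * pi)^-1)%:C%C * G x).
    by apply/funext => x; rewrite /G; ring.
  have ck : c * (k * ((2 * pi)^-1)%:C%C) = 1.
    have pi_pos := @pi_gt0 R.
    have p2 : 2 * pi != 0 :> R by apply: lt0r_neq0; rewrite mulr_gt0.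
    have -> : c * (k * ((2 * pi)^-1)%:C%C) = (c / c) * ((2 * pi)%:C%C * ((2 * pi)^-1)%:C%C).
      by rewrite /k; ring.
    by rewrite (mulfV c_neq0) mul1r -rmorphM/= (mulfV p2).
  have E2 : c * cint (fun x => k * f (modulate x phi) * ((2 * pi)^-1)%:C%C * fourier psi (- x)) =
      cint G by rewrite EG (cintZ _ iG) mulrA ck mul1r.
  exact: mulfI c_neq0 _ _ (etrans E1 (esym E2)).
Qed.

End Representation.

(** Being a local pseudofunction is tested point by point, so the union of all admissible open sets
    is itself admissible. *)
Lemma sing_supp_PFE (U : set R) (f : (R -> C) -> C) : exists W : set R,
  [/\ open W, W `<=` U, local_pseudofunction W f, sing_supp_PF U f = U `\` W &
    forall V : set R, open V -> V `<=` U -> local_pseudofunction V f -> V `<=` W].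
Proof.
pose W := \bigcup_(V in [set V : set R | [/\ open V, V `<=` U & local_pseudofunction V f]]) V.
exists W; split => //.
- by apply: bigcup_open => V [].
- by move=> x [V [_ VU _]] /VU.
- move=> x [V [oV VU fV] Vx]; have [V' [oV' V'x V'V cV']] := fV x Vx.
  by exists V'; split => // y /V'V Vy; exists V.
- by move=> V oV VU fV x Vx; exists V.
Qed.

End Main.

Theorem theorem4p1 (R : realType) (U : set R) (f : (R -> R[i]) -> R[i]) (E : set R) :
  open U -> is_distribution U f ->
  E `<=` U -> (exists F : set R, closed F /\ E = U `&` F) ->
  (@lebesgue_measure R).-negligible E ->
  sing_supp_PF U f `<=` E ->
  (forall t0, E t0 -> exists (V : set R) (f0 : (R -> R[i]) -> R[i]),
     [/\ open V, V t0, V `<=` U, is_distribution V f0 & local_pseudomeasure V f0] /\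
     forall phi, test_fun V phi -> f phi = f0 (fun t => (t - t0)%:C%C * phi t)) ->
  sing_supp_PF U f = set0 /\ local_pseudofunction U f.
Proof.
move=> oU fP EU _ E0 SE hyp.
have [W [oW WU fW SW maxW]] := sing_supp_PFE U f.
suff fU : local_pseudofunction U f.
  split => //; rewrite SW; apply/seteqP; split => // x [Ux]; apply.
  exact: (maxW U).
have [triv|/existsNP [phi /not_implyP [tphi phi0]]] :=
    pselect (forall phi, test_fun U phi -> phi = fun=> 0).
  exact: trivial_local_pseudofunction.
have [p php] : exists p, phi p != 0.
  apply: contrapT => /forallNP h; apply: phi0; apply/funext => x.
  by have /negP := h x; rewrite negbK => /eqP.
have [b bP] := bump_exists tphi php.
have [s sP] := smooth_step_exists bP.
have [c [c_neq0 cP]] : exists c : R[i], c != 0 /\ inversion_constant c.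
  by case: bP => sb b_ge0 b1 [r b0]; exact: inversion_constant_exists sb b0 b_ge0 b1.
pose S := U `&` ~` W.
have SU : S `<=` E by move: SE; rewrite SW.
have repr (t0 : R) : S t0 -> exists (r M : R) (V : set R) (h0 : R -> R[i]),
    [/\ 0 < r, 0 <= M, forall x, `|x - t0| <= r -> V x & V `<=` U] /\
    [/\ Linf h0, forall x, cabs (h0 x) <= M & forall phi, test_fun V phi ->
      f phi = inv_fourier_pair h0 (fun t => (t - t0)%:C%C * phi t)].
  move=> /SU /hyp [V [f0 [[oV Vt0 VU _ pm] ff0]]].
  have [V' [oV' V't0 V'V [h0 [hL hE]]]] := pm t0 Vt0.
  have /nbhs_ballP[r /= r0 Hr] : nbhs t0 V' by exact: open_nbhs_nbhs.
  have [m1 [m2 [M hM]]] := hL.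
  exists (r / 2), M, V', h0; split; split.
  - by rewrite divr_gt0.
  - exact: le_trans (cabs_ge0 _) (hM 0).
  - by move=> x xr; apply: Hr; rewrite /ball/= distrC; lra.
  - exact: subset_trans V'V VU.
  - exact: hL.
  - exact: hM.
  - move=> psi tpsi; rewrite (ff0 _ (test_funS V'V tpsi)) hE//.
    by apply: test_funM => //; apply: csmooth_real; apply: smoothB; [exact: smooth_id|exact: smooth_cst].
suff S0 : S = set0.
  have UW : U `<=` W by move=> x Ux; apply: contrapT => nWx; rewrite -[False]/(set0 x) -S0.
  move=> x /UW /fW [V [oV Vx VW cV]]; exists V; split => //.
  exact: subset_trans VW WU.
apply/eqP; rewrite -[_ == _]negbK; apply/negP => /set0P Sn0.
(* One integer controls both the constant and the radius, so that countably many sets exhaust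
   [S]. *)
pose D (n : nat) : set R := [set t | S t /\ forall psi, test_fun U psi ->
  (forall x, n.+1%:R^-1 <= `|x - t| -> psi x = 0) ->
  cabs (f psi) <= n%:R * Anorm (fun x => (x - t)%:C%C * psi x)].
have SD x : S x -> exists n, D n x.
  move=> Sx; have [r [M [V [h0 [[r0 M0 Vr VU] [hL hM hE]]]]]] := repr x Sx.
  have [m1 [m2 _]] := hL; have mh : cmeas h0 by [].
  have [n1 Hn1] := ltr_add_invr r0; rewrite add0r in Hn1.
  (* [n1] makes the radius small enough for the representation at [x]; the other term exceeds the
     constant of [cabs_inv_fourier_pair]. *)
  pose n := maxn n1 (Num.truncn (M / pi)).+1.
  exists n; split => // psi tpsi psi0.
  have nn : n.+1%:R^-1 <= r.
    rewrite (le_trans _ (ltW Hn1))// lef_pV2 ?posrE ?ltr0n// ler_nat ltnS.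
    exact: leq_maxl.
  have [spsi _] := test_funP tpsi.
  have tV : test_fun V psi.
    apply: (@test_fun_restrict R V x n.+1%:R^-1) => //.
    - by move=> y xy; apply: psi0; exact: ltW.
    - by move=> y xy; apply: Vr; rewrite (le_trans xy).
  have st : csmooth (fun t : R => (t - x)%:C%C : R[i]).
    by apply: csmooth_real; apply: smoothB; [exact: smooth_id|exact: smooth_cst].
  have [r' p0'] := (test_funP tpsi).2.
  rewrite (hE _ tV).
  apply: (le_trans (cabs_inv_fourier_pair mh hM (csmoothM st spsi) (supp_in_mull _ p0'))).
  rewrite ler_wpM2r ?Anorm_ge0// (le_trans (ltW (truncnS_gt _)))// ler_nat.
  exact: leq_maxr.
have cW : closed (~` W) by exact: open_closedC.
have [n [x0 [rho [Sx0 rho0 dense]]]] := @baire_relatively_closed R U (~` W) D oU cW Sn0 SD.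
have [r1 [M [V [h0 [[r10 M0 Vr VU] [hL hM hE]]]]]] := repr x0 Sx0.
(* The plateau reaches out to [2 * r], which must lie within [r1] for the representation and
   strictly within [rho] for the density. *)
pose r := Num.min r1 rho / 4.
have mr : 0 < Num.min r1 rho by rewrite lt_min r10 rho0.
have r0 : 0 < r by rewrite divr_gt0.
have rr1 : 4 * r <= r1 by rewrite /r mulrC divfK// ge_min lexx.
have rrho : 4 * r <= rho by rewrite /r mulrC divfK// ge_min lexx orbT.
have V2 x : `|x - x0| <= 2 * r -> V x by move=> xr; apply: Vr; lra.
have tp : test_fun V (plateau s x0 r).
  apply: (@test_fun_restrict R V x0 (2 * r)) => //; first exact: csmooth_plateau.
  by move=> x x2; rewrite (plateau0 sP r0)// ltW.
have dec : decays f (plateau s x0 r).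
  apply: (decays_null fP sP c_neq0 cP (W := W) (D := D n) (a := x0 - 2 * r)
    (b := x0 + 2 * r) (kappa := n.+1%:R^-1) (M := n%:R)) => //.
  - apply: negligibleS E0 => x [xr nWx]; apply: SU; split => //.
    by apply/VU/V2; move: xr; rewrite /= in_itv/= -ler_distl.
  - move=> x xr nWx e e0; apply: dense => //.
      by split => //; apply/VU/V2; rewrite ler_distl.
    by move: xr; rewrite -ler_distl; lra.
  - by move=> t psi [_ ]; apply.
  - exact: test_funS VU tp.
  - by move=> x; rewrite -ler_distl -ltNge => xr; rewrite (plateau0 sP r0)// ltW.
have pf := pseudofunction_of_decay c_neq0 cP sP r0 V2 hL hE dec.
(* By maximality [W] contains the ball, whereas its centre [x0] was taken outside [W]. *)
case: Sx0 => _; apply; apply: (maxW (ball x0 r)).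
- exact: ball_open.
- by move=> x; rewrite /ball/= distrC => xr; apply/VU/V2; lra.
- move=> x xr; exists (ball x0 r); split => //; exact: ball_open.
- exact: ballxx.
Qed.
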